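(* Let $\mathcal{H}$ be the set of probability measures on $\mathbb{Z}$ satisfying hypothesis (H), and let $\mathcal{R}$ be the set of Ritt probability measures on $\mathbb{Z}$ (both defined in the context). Then: (i) The set $\mathcal{H}$ is convex and stable by convolution and by symmetrization. (ii) The set $\mathcal{R}$ is convex and stable by convolution and by symmetrization. (iii) If $\mu\in\mathcal{H}$, then there exists $C>0$ such that for every $f\in\ell^1(\mathbb{Z})$ and every $\lambda>0$, $$\#\{k\in\mathbb{Z} : \sup_{n\ge 1}|\mu^{*n}*f(k)|>\lambda\}\le \frac{C}{\lambda}\|f\|_{\ell^1(\mathbb{Z})}.$$ (iv) If $\mu\in\mathcal{H}\cap\mathcal{R}$, then for every $m\in\mathbb{N}$ there exists $C_m>0$ such that for every $f\in\ell^1(\mathbb{Z})$, $$\sup_{\lambda>0}\lambda\,\#\{k\in\mathbb{Z} : \sup_{n\ge 1} n^m|\mu^{*n}*(\delta_0-\mu)^{*m}*f(k)|\ge\lambda\}\le C_m\|f\|_{\ell^1(\mathbb{Z})}.$$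
   Context: $\mathbb{N}=\{0,1,2,\ldots\}$. For a finite (signed) measure $\mu$ on $\mathbb{Z}$, $\hat\mu(\theta)=\sum_{n\in\mathbb{Z}}\mu(n)e^{in\theta}$; $*$ is convolution on $\mathbb{Z}$, $\mu^{*n}$ is the $n$-th convolution power, and $(\delta_0-\mu)^{*0}=\delta_0$. Hypothesis (H): a probability measure $\mu$ on $\mathbb{Z}$ satisfies (H) if $\hat\mu$ is twice continuously differentiable on $[-\pi,\pi]\setminus\{0\}$ and there exist an even continuous function $\psi$ on $[-\pi,\pi]$, vanishing at $0$ and continuously differentiable on $[-\pi,\pi]\setminus\{0\}$, and constants $c,C>0$ such that for every $\theta\in(0,\pi]$: $|\hat\mu(\theta)|\le 1-c\psi(\theta)$; $|\theta\hat\mu'(\theta)|\le C\psi(\theta)$; $|\hat\mu'(\theta)|\le C\psi'(\theta)$; $|\theta\hat\mu''(\theta)|\le C\psi'(\theta)$. Ritt: a probability measure $\mu$ on $\mathbb{Z}$ is Ritt if $\sup_{n\ge1}n\|\mu^{*n}-\mu^{*(n+1)}\|_{\ell^1(\mathbb{Z})}<\infty$. A set of probability measures on $\mathbb{Z}$ is stable by symmetrization if whenever it contains $\mu=(\mu(n))_{n\in\mathbb{Z}}$ it also contains $\check\mu=(\mu(-n))_{n\in\mathbb{Z}}$. *)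

(* Defs.v *)
From HB Require Import structures.
From mathcomp Require Import all_boot all_order all_algebra.
From mathcomp Require Import all_classical all_reals all_analysis.
From mathcomp Require Import complex.

Set Implicit Arguments.
Unset Strict Implicit.
Unset Printing Implicit Defensive.

Import Order.TTheory GRing.Theory Num.Theory.
Import numFieldNormedType.Exports.

Local Open Scope classical_set_scope.
Local Open Scope ring_scope.

(* [int] carries the discrete sigma-algebra, so that absolutely convergent sums
   over the integers are integrals with respect to [counting]. *)
HB.instance Definition _ := isPointed.Build int 0%Z.
HB.instance Definition _ := @isMeasurable.Build default_measure_display
  int discrete_measurable discrete_measurable0
  discrete_measurableC discrete_measurableU.

Section Sequences.
Context {R : realType}.

(* Finite signed measures on the integers are represented by their point
   masses [int -> R]; elements of l^1 are complex-valued. *)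

Definition csum (F : int -> R[i]) : R[i] :=
  ((\int[counting]_n complex.Re (F n)) +i*
   (\int[counting]_n complex.Im (F n)))%C.

Definition l1norm (f : int -> R[i]) : \bar R :=
  (\int[counting]_n (Normc.normc (f n))%:E)%E.

Definition l1 : set (int -> R[i]) := [set f | (l1norm f < +oo)%E].

Definition is_prob (mu : int -> R) : Prop :=
  (forall n, 0 <= mu n) /\ (\int[counting]_n (mu n)%:E = 1)%E.

Definition delta0 (n : int) : R := (n == 0)%:R.

Definition convol (a b : int -> R) (k : int) : R :=
  \int[counting]_j (a j * b (k - j)).

Definition convol_pow (a : int -> R) (n : nat) : int -> R :=
  iter n (convol a) delta0.

(* [a * f] for a real signed measure [a] and a complex-valued [f]. *)
Definition cconvol (a : int -> R) (f : int -> R[i]) (k : int) : R[i] :=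
  csum (fun j => (a j)%:C%C * f (k - j)).

Definition symm (mu : int -> R) (n : int) : R := mu (- n).

Definition fourier (mu : int -> R) (t : R) : R[i] :=
  csum (fun n => (mu n)%:C%C * (cos (n%:~R * t) +i* sin (n%:~R * t))%C).

End Sequences.

Section Derivatives.
Context {R : realType}.

(* The difference quotient is restricted to [D]; hence the derivative is
   one-sided at the endpoints of an interval. *)
Definition deriv_within (D : set R) (f : R -> R) (x l : R) : Prop :=
  (f y - f x) / (y - x) @[y --> within D x^'] --> l.

Definition C1_on (D : set R) (f f' : R -> R) : Prop :=
  (forall x, D x -> deriv_within D f x (f' x)) /\ {within D, continuous f'}.

Definition cC1_on (D : set R) (F F' : R -> R[i]) : Prop :=
  C1_on D (fun x => complex.Re (F x)) (fun x => complex.Re (F' x)) /\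
  C1_on D (fun x => complex.Im (F x)) (fun x => complex.Im (F' x)).

End Derivatives.

Section Hypotheses.
Context {R : realType}.

Definition punctured : set R := `[- pi, pi]%classic `\ 0.

(* [F1], [F2] and [psi'] are determined on [punctured] by the [C1] conditions:
   they are the first two derivatives of [fourier mu] and the derivative of
   [psi]. *)
Definition hypH (mu : int -> R) : Prop :=
  exists (F1 F2 : R -> R[i]) (psi psi' : R -> R) (c C : R),
    [/\ cC1_on punctured (fourier mu) F1 /\ cC1_on punctured F1 F2,
        [/\ forall t : R, t \in `[- pi, pi] -> psi (- t) = psi t,
            {within `[- pi, pi], continuous psi},
            psi 0 = 0 &
            C1_on punctured psi psi'],
        0 < c /\ 0 < C &
        forall t : R, t \in `]0, pi] ->
          [/\ Normc.normc (fourier mu t) <= 1 - c * psi t,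
              Normc.normc (t%:C%C * F1 t) <= C * psi t,
              Normc.normc (F1 t) <= C * psi' t &
              Normc.normc (t%:C%C * F2 t) <= C * psi' t]].

Definition H_measures : set (int -> R) := [set mu | is_prob mu /\ hypH mu].

Definition ritt (mu : int -> R) : Prop :=
  (ereal_sup [set n%:R%:E *
     l1norm (fun k => (convol_pow mu n k - convol_pow mu n.+1 k)%:C%C)
   | n in [set n : nat | (1 <= n)%N]] < +oo)%E.

Definition Ritt_measures : set (int -> R) := [set mu | is_prob mu /\ ritt mu].

Definition convol_stable (S : set (int -> R)) : Prop :=
  forall mu nu, S mu -> S nu -> S (convol mu nu).

Definition symm_stable (S : set (int -> R)) : Prop :=
  forall mu, S mu -> S (symm mu).

End Hypotheses.

(* Main.v *)
From HB Require Import structures.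
Require Import Defs.
From mathcomp Require Import all_boot all_order all_algebra.
From mathcomp Require Import all_classical all_reals all_analysis.
From mathcomp Require Import complex.
From mathcomp Require Import measurable_realfun.
From mathcomp Require Import ring lra zify.

(** The summable sequences on the integers form a commutative Banach algebra under
    convolution, of which the Fourier transform is a character for each [t]; below
    this is the ring [ell1 R] with the norm [norm1] and the morphisms [four t].

    For the spectral hypothesis, the sum of the functions [psi] of two measures
    serves both their convolution and their convex combinations ([hypH_convol],
    [hypH_conv]), and symmetrization conjugates the transform.
    For Ritt measures, stability under convolution comes from
    [1 - mu nu = (1 - mu) + mu (1 - nu)], and convexity from expanding
    [(r mu + (1 - r) nu) ^ n] by the binomial theorem, where the weights
    [C(n, i) / (n - i + 1)] produced by the bound on [mu ^ (n - i) (1 - mu)] are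
    [C(n + 1, i) / (n + 1)] ([ritt_conv_half]).

    Both maximal inequalities concern the kernels
    [K_n = n ^ m mu ^ n (1 - mu) ^ m], with [m = 0] for the first one.  They are
    bounded in norm uniformly in [n]: trivially if [m = 0], and by splitting
    [mu ^ n] into [m + 1] blocks, through repeated halving, for Ritt measures
    ([ritt_power_bound]).  Under the spectral hypothesis they also satisfy
    [|K_n x - K_n (x + 1)| <= D / x ^ 2] uniformly in [n] ([kernel_regular]).
    Indeed this difference is the Fourier coefficient of
    [k t (1 - exp (- i t))], where [k] is the transform of [K_n], and two
    integrations by parts bound it by [x ^ -2] times the total variation of the
    derivative.  The hypothesis controls [k], [t k'], [k'] and [t k''] by
    [exp (- d n psi)] with an additional factor [n psi'] for the last two; the
    factor [1 - exp (- i t) = O(t)] absorbs the singularity at [0], and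
    [n psi' exp (- d n psi)], being up to the factor [- d] the derivative of
    [exp (- d n psi)], has an integral bounded independently of [n].

    Norm bounds and regularity together give the weak type inequality
    ([weak_type_real]) by the method of Calderon and Zygmund.  Write [f] as a
    function bounded by a multiple of [lambda] plus atoms of mean zero carried by
    intervals of total length [O(|f| / lambda)].  The bounded part stays bounded
    under all [K_n]; an atom [b] carried by an interval [I] contributes at most
    [O(|b| |I| / x ^ 2)] at distance [x] from it, which sums to [O(|b|)] outside
    an enlargement of [I], while the enlargements have total length
    [O(|f| / lambda)]. *)

Set Implicit Arguments.
Unset Strict Implicit.
Unset Printing Implicit Defensive.

Import Order.TTheory GRing.Theory Num.Theory.
Import numFieldNormedType.Exports.

Local Open Scope classical_set_scope.
Local Open Scope ring_scope.

(** * Absolutely summable families over the integers *)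

Section summation.
Context {R : realType}.
Implicit Types (f g : int -> R) (k : int).

Definition absum f := (@counting int R).-integrable setT (EFin \o f).

Lemma absumP f : absum f <-> (\int[counting]_n `|f n|%:E < +oo)%E.
Proof.
by split=> [/integrableP[_ //]|fy]; apply/integrableP.
Qed.

Lemma le_absum f g : (forall n, `|f n| <= g n) -> absum g -> absum f.
Proof.
move=> fg; apply: le_integrable => // n _ /=.
by rewrite lee_fin (le_trans (fg n))// ler_norm.
Qed.

Lemma absumD f g : absum f -> absum g -> absum (fun n => f n + g n).
Proof. by move=> sf sg; exact: (integrableD _ sf sg). Qed.

Lemma absumB f g : absum f -> absum g -> absum (fun n => f n - g n).
Proof. by move=> sf sg; exact: (integrableB _ sf sg). Qed.

Lemma absumZ c f : absum f -> absum (fun n => c * f n).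
Proof. by move=> sf; exact: (integrableZl _ c sf). Qed.

Lemma absum_norm f : absum f -> absum (fun n => `|f n|).
Proof. by move=> sf; exact: (integrable_norm sf). Qed.

Lemma absumMr f g M : (forall n, `|g n| <= M) -> absum f ->
  absum (fun n => f n * g n).
Proof.
move=> gM sf; apply: (@le_absum _ (fun n => M * `|f n|)).
  by move=> n; rewrite normrM mulrC ler_wpM2r.
exact/absumZ/absum_norm.
Qed.

Lemma eq_sumZ f g : f =1 g ->
  \int[counting]_n f n = \int[counting]_n g n.
Proof. by move=> /funext ->. Qed.

Lemma EFin_sumZ f : absum f ->
  (\int[counting]_n (f n)%:E = (\int[counting]_n f n)%:E)%E.
Proof. by move=> sf; rewrite /Rintegral fineK//; exact: integrable_fin_num. Qed.

(** Stated for sets and through an explicit inverse, so that the change of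
    variables in sums becomes a push-forward of counting measure onto itself. *)
Lemma counting_preimage (s t : int -> int) (A : set int) :
  cancel s t -> cancel t s -> counting (s @^-1` A) = counting A :> \bar R.
Proof.
move=> st ts; have E : t @` A = s @^-1` A.
  by apply/seteqP; split=> [_ [x Ax <-]|x Ax] /=; [rewrite ts|exists (s x)].
rewrite -E /counting; have : (t @` A #= A)%card.
  by apply: inj_card_eq => x y _ _; exact: (can_inj ts).
move=> AA; case: asboolP => [fA|nfA]; case: asboolP => [fB|nfB] //.
- have [n An] := (finite_setP A).1 fB.
  by rewrite (card_fset_set An) (card_fset_set (card_eq_trans AA An)).
- by case: nfB; rewrite -(eq_finite_set AA).
- by case: nfA; rewrite (eq_finite_set AA).
Qed.

Lemma pushforward_counting (s t : int -> int) :
  cancel s t -> cancel t s -> pushforward counting s = counting :> (_ -> \bar R).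
Proof. by move=> st ts; apply/funext => A; exact: (counting_preimage A st ts). Qed.

Lemma ge0_sumZ_bij (s t : int -> int) (f : int -> \bar R) :
  cancel s t -> cancel t s -> (forall n, 0 <= f n)%E ->
  (\int[counting]_n f (s n) = \int[counting]_n f n :> \bar R)%E.
Proof.
move=> st ts f0.
rewrite -[in RHS](pushforward_counting st ts).
by rewrite (ge0_integral_pushforward (phi := s)).
Qed.

Lemma absum_bij (s t : int -> int) f :
  cancel s t -> cancel t s -> absum f -> absum (f \o s).
Proof.
move=> st ts /absumP fy; apply/absumP.
by rewrite (ge0_sumZ_bij (f := fun n => `|f n|%:E) st ts).
Qed.

Lemma sumZ_bij (s t : int -> int) f :
  cancel s t -> cancel t s -> absum f ->
  \int[counting]_n f (s n) = \int[counting]_n f n.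
Proof.
move=> st ts sf; rewrite /Rintegral; congr fine.
have bij (g : int -> \bar R) : (forall n, 0 <= g n)%E ->
    (\int[counting]_n g (s n) = \int[counting]_n g n :> \bar R)%E.
  exact: ge0_sumZ_bij st ts.
rewrite [LHS]integralE [RHS]integralE -[in RHS](bij _ (funepos_ge0 _)).
rewrite -[in RHS](bij _ (funeneg_ge0 _)).
by congr (_ - _)%E; apply: eq_integral => n _; rewrite ?funepos.unlock ?funeneg.unlock.
Qed.

Lemma sumZ_refl k f : absum f ->
  \int[counting]_n f (k - (n : int)) = \int[counting]_n f n.
Proof. by apply: (@sumZ_bij (fun n => k - n) (fun n => k - n)) => n; rewrite subKr. Qed.

Lemma absum_shift k f : absum f -> absum (fun n => f (n + k)).
Proof.
by apply: (@absum_bij (fun n => n + k) (fun n => n - k)) => n; rewrite ?addrK ?subrK.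
Qed.

Lemma sumZ_shift k f : absum f ->
  \int[counting]_n f ((n : int) + k) = \int[counting]_n f n.
Proof.
by apply: (@sumZ_bij (fun n => n + k) (fun n => n - k)) => n; rewrite ?addrK ?subrK.
Qed.

Lemma counting_set1 (a : int) : counting [set a] = 1%E :> \bar R.
Proof.
by rewrite /counting asboolT// (card_fset_set card_set1).
Qed.

Lemma integral_indic1 (a : int) :
  (\int[counting]_n (\1_[set a] n)%:E = 1 :> \bar R)%E.
Proof. by rewrite integral_indic// setIT; exact: counting_set1. Qed.

Lemma integrable_indic1 (a : int) :
  (@counting int R).-integrable setT (EFin \o \1_[set a]).
Proof. apply/integrableP; split=> //; under eq_integral do rewrite /= ger0_norm//.
by rewrite integral_indic1 ltry. Qed.

Lemma sumZ_single (a : int) f : (forall n, n != a -> f n = 0) ->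
  \int[counting]_n f n = f a.
Proof.
move=> fa; rewrite /Rintegral.
rewrite (eq_integral (fun n : int => ((f a) * \1_[set a] n)%:E)); last first.
  move=> n _; rewrite indicE in_set1; case: eqVneq => [->|/fa ->].
    by rewrite mulr1.
  by rewrite mulr0.
under eq_integral do rewrite EFinM.
rewrite integralZl//; last exact: integrable_indic1.
by rewrite integral_indic1 mule1.
Qed.

Lemma ge0_le_sum1 (f : int -> \bar R) a : (forall n, 0 <= f n)%E ->
  (f a <= \int[counting]_n f n)%E.
Proof.
move=> f0; apply: (@le_trans _ _ (\int[counting]_n (f a * (\1_[set a] n)%:E))%E).
  rewrite ge0_integralZl//; first by rewrite integral_indic1 mule1.
apply: ge0_le_integral => //= n _.
  by rewrite mule_ge0// lee_fin.
rewrite indicE in_set1; case: eqVneq => [->|_]; first by rewrite mule1.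
by rewrite mule0.
Qed.

Lemma ler_sumZ f g : absum f -> absum g -> (forall n, f n <= g n) ->
  \int[counting]_n f n <= \int[counting]_n g n.
Proof. by move=> sf sg fg; apply: le_Rintegral. Qed.

Lemma counting_sigma_finite_int : sigma_finite [set: int] (@counting int R).
Proof.
exists (fun n => [set k : int | (`|k| <= n%:Z)]).
  by apply/seteqP; split=> // k _; exists `|k|%N => //=; rewrite abszE.
move=> n; split => //; rewrite /counting/= asboolT ?ltry//.
apply: (@sub_finite_set _ _ ((fun i : nat => i%:Z) @` `I_n.+1 `|`
   (fun i : nat => - i%:Z) @` `I_n.+1)).
  move=> k /=; case: (lerP 0 k) => k0 kn.
    by left; exists `|k|%N => /=; lia.
  by right; exists `|k|%N => /=; lia.
by rewrite finite_setU; split; apply: finite_image; exact: finite_II.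
Qed.

End summation.

(** Under a name of its own, counting measure on [int] carries the sigma-finite
    structure on which Fubini's theorem depends. *)
Definition countingZ (R : realType) : set int -> \bar R := @counting int R.
HB.instance Definition _ (R : realType) :=
  Measure.copy (@countingZ R) (@counting int R).
HB.instance Definition _ (R : realType) :=
  @Measure_isSigmaFinite.Build _ _ _ (@countingZ R) (@counting_sigma_finite_int R).

Section fubini_int.
Context {R : realType}.

Lemma measurable_int2 (A : set (int * int)) : measurable A.
Proof.
have -> : A = \bigcup_(n in [set: int]) ([set n] `*` [set m | A (n, m)]).
  apply/seteqP; split=> [[n m] Anm|[n m] [k _ [/= -> //]]].
  by exists n.
by apply: countable_bigcupT_measurable => // n; exact: measurableX.
Qed.

Lemma emeasurable_fun_int2 (f : int * int -> \bar R) : measurable_fun setT f.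
Proof. by move=> _ B mB; exact: measurable_int2. Qed.

Lemma ge0_sumZ_sumZ (f : int -> int -> \bar R) : (forall i j, 0 <= f i j)%E ->
  (\int[counting]_i \int[counting]_j f i j =
   \int[counting]_j \int[counting]_i f i j)%E.
Proof.
move=> f0.
have mf := emeasurable_fun_int2 (fun x => f x.1 x.2).
exact: (@fubini_tonelli _ _ int int R (@countingZ R) (@countingZ R) _ mf
  (fun x => f0 x.1 x.2)).
Qed.

Lemma sumZ_sumZ (f : int -> int -> R) :
  (\int[counting]_i \int[counting]_j `|f i j|%:E < +oo :> \bar R)%E ->
  \int[counting]_i \int[counting]_j f i j =
  \int[counting]_j \int[counting]_i f i j.
Proof.
move=> fy; pose F := fun x : int * int => (f x.1 x.2)%:E.
have mF := emeasurable_fun_int2 F.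
have iF : ((@countingZ R) \x (@countingZ R))%E.-integrable setT F.
  exact: ((integrable12ltyP (@countingZ R) (@countingZ R) mF).2 fy).
have row i : absum (f i).
  apply/absumP; apply: le_lt_trans fy.
  apply: (ge0_le_sum1 (f := fun i => \int[counting]_j `|f i j|%:E)%E) => k.
  by apply: integral_ge0 => j _; rewrite lee_fin.
have fy2 : (\int[counting]_j \int[counting]_i `|f i j|%:E < +oo :> \bar R)%E.
  by rewrite -ge0_sumZ_sumZ// => i j; rewrite lee_fin.
have col j : absum (f^~ j).
  apply/absumP; apply: le_lt_trans fy2.
  apply: (ge0_le_sum1 (f := fun j => \int[counting]_i `|f i j|%:E)%E) => k.
  by apply: integral_ge0 => i _; rewrite lee_fin.
have := Fubini iF; rewrite /F /=.
under eq_integral do rewrite (EFin_sumZ (row _)).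
under [X in _ = X -> _]eq_integral do rewrite (EFin_sumZ (col _)).
by rewrite /Rintegral => ->.
Qed.

End fubini_int.

(** * The convolution algebra of summable sequences *)

Section summation_theory.
Context {R : realType}.
Implicit Types (f g : int -> R) (k : int).

Lemma sumZD f g : absum f -> absum g ->
  \int[counting]_n (f n + g n) = \int[counting]_n f n + \int[counting]_n g n.
Proof. by move=> sf sg; rewrite RintegralD. Qed.

Lemma sumZB f g : absum f -> absum g ->
  \int[counting]_n (f n - g n) = \int[counting]_n f n - \int[counting]_n g n.
Proof. by move=> sf sg; rewrite RintegralB. Qed.

Lemma sumZZ c f : absum f ->
  \int[counting]_n (c * f n) = c * \int[counting]_n f n.
Proof. by move=> sf; rewrite RintegralZl. Qed.

Lemma ler_norm_sumZ f : absum f ->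
  `|\int[counting]_n f n| <= \int[counting]_n `|f n|.
Proof. by move=> sf; apply: le_normr_Rintegral. Qed.

Lemma absum0 : absum (fun _ : int => 0 : R).
Proof. exact: integrable0. Qed.

Lemma sumZ0 : \int[counting]_(n in [set: int]) (0 : R) = 0.
Proof. by rewrite /Rintegral integral0. Qed.

Lemma ler_norm_sum1 f k : absum f -> `|f k| <= \int[counting]_n `|f n|.
Proof.
move=> sf; rewrite -lee_fin -EFin_sumZ; last exact: absum_norm.
by apply: (ge0_le_sum1 (f := fun n => `|f n|%:E)%E) => n; rewrite lee_fin.
Qed.

Lemma absum_convol2 (a b : int -> R) : absum a -> absum b ->
  (\int[counting]_k \int[counting]_j `|a j * b ((k : int) - j)|%:E < +oo)%E.
Proof.
move=> sa sb; rewrite ge0_sumZ_sumZ; last by move=> ? ?; rewrite lee_fin.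
pose B := \int[counting]_n `|b n|.
rewrite (eq_integral (fun j : int => (B%:E * `|a j|%:E)%E)).
  rewrite ge0_integralZl// ?lee_fin ?Rintegral_ge0//.
  by apply: lte_mul_pinfty; rewrite ?lee_fin ?Rintegral_ge0//; exact/absumP.
move=> j _; under eq_integral do rewrite normrM EFinM.
rewrite ge0_integralZl//.
rewrite muleC; congr (_ * _)%E.
rewrite (EFin_sumZ (f := fun k => `|b (k - j)|)).
  by rewrite (sumZ_shift (- j) (absum_norm sb)).
exact/absum_norm/(absum_shift (- j) sb).
Qed.

Lemma absum_convol_term (a b : int -> R) k : absum a -> absum b ->
  absum (fun j => a j * b (k - j)).
Proof.
move=> sa sb; apply: (@absumMr _ _ _ (\int[counting]_n `|b n|)) => // n.
exact: ler_norm_sum1.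
Qed.

Lemma absum_convol (a b : int -> R) : absum a -> absum b -> absum (convol a b).
Proof.
move=> sa sb; apply/absumP; apply: le_lt_trans (absum_convol2 sa sb).
apply: ge0_le_integral => // k _; rewrite EFin_sumZ; last exact/absum_norm/absum_convol_term.
by rewrite lee_fin; apply/ler_norm_sumZ/absum_convol_term.
Qed.

(** Convolution is the image of the product measure under addition: this single
    change of variables yields associativity, multiplicativity of the Fourier
    transform and submultiplicativity of the norm, for various [phi]. *)
Lemma sumZ_convol (a b phi : int -> R) (M : R) : absum a -> absum b ->
  (forall n, `|phi n| <= M) ->
  \int[counting]_k (convol a b k * phi k) =
  \int[counting]_j (a j * \int[counting]_l (b l * phi (j + l))).
Proof.
move=> sa sb phiM.
transitivity (\int[counting]_k \int[counting]_j (a j * b ((k : int) - j) * phi k)).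
  apply: eq_sumZ => k; rewrite /convol.
  by rewrite RintegralZr//; exact: absum_convol_term.
rewrite sumZ_sumZ.
  apply: eq_sumZ => j; under eq_Rintegral do rewrite -mulrA.
  have sbp : absum (fun l => b l * phi (j + l)) by apply: (absumMr (M := M)).
  have := absum_shift (- j) sbp; have := sumZ_shift (- j) sbp => /=.
  under eq_Rintegral do rewrite addrCA subrr addr0.
  move=> <- sbp'; rewrite RintegralZl//.
  apply: eq_integrable sbp' => // k _.
  by rewrite /= (addrCA j) subrr addr0.
have M0 : 0 <= M by exact: le_trans (phiM 0).
apply: (@le_lt_trans _ _
  (\int[counting]_k (M%:E * \int[counting]_j `|a j * b ((k : int) - j)|%:E))%E).
  apply: ge0_le_integral => //.
    by move=> k _; apply: integral_ge0 => j _; rewrite lee_fin.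
  move=> k _; rewrite -ge0_integralZl//.
  apply: ge0_le_integral => // j _.
  by rewrite lee_fin normrM mulrC ler_wpM2r.
rewrite ge0_integralZl//.
  by apply: lte_mul_pinfty; rewrite ?lee_fin//; exact: absum_convol2.
by move=> k _; apply: integral_ge0 => j _; rewrite lee_fin.
Qed.

Lemma convolC (a b : int -> R) : absum a -> absum b -> convol a b = convol b a.
Proof.
move=> sa sb; apply/funext => k; rewrite /convol.
rewrite -(sumZ_refl k (absum_convol_term k sa sb)).
by apply: eq_sumZ => j; rewrite subKr mulrC.
Qed.

Lemma convolA (a b c : int -> R) : absum a -> absum b -> absum c ->
  convol a (convol b c) = convol (convol a b) c.
Proof.
move=> sa sb sc; apply/funext => k; rewrite /convol -/(convol b c) -/(convol a b).
rewrite [RHS](sumZ_convol (phi := fun j => c (k - j))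
    (M := \int[counting]_n `|c n|) sa sb).
  apply: eq_sumZ => j; congr (_ * _).
  by apply: eq_sumZ => l; rewrite opprD addrA.
by move=> n; exact: ler_norm_sum1.
Qed.

Lemma convolDl (a b c : int -> R) : absum a -> absum b -> absum c ->
  convol (a + b) c = convol a c + convol b c.
Proof.
move=> sa sb sc; apply/funext => k; rewrite /convol.
under eq_Rintegral do rewrite mulrDl.
by rewrite sumZD//; exact: absum_convol_term.
Qed.

Lemma delta0E (k : int) : delta0 k = (k == 0)%:R :> R. Proof. by []. Qed.

Lemma convol1l (a : int -> R) : convol delta0 a = a.
Proof.
apply/funext => k; rewrite /convol (sumZ_single (a := 0)).
  by rewrite delta0E eqxx mul1r subr0.
by move=> n /negbTE n0; rewrite delta0E n0 mul0r.
Qed.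

Lemma absum_delta0 : absum (@delta0 R).
Proof.
rewrite (_ : delta0 = \1_[set 0]); first exact: integrable_indic1.
by apply/funext => n; rewrite indicE in_set1.
Qed.

(** Summability as a boolean predicate on functions, from which [ell1] inherits its
    group structure as a subtype; with convolution it becomes a commutative algebra,
    and the identities between powers of measures used below are ring identities. *)
Definition ell1_pred : {pred int -> R} := fun f => `[< absum f >].

Fact ell1_zmod_closed : zmod_closed ell1_pred.
Proof.
split; first exact/asboolP/absum0.
by move=> f g /asboolP sf /asboolP sg; exact/asboolP/(absumB sf sg).
Qed.

HB.instance Definition _ :=
  GRing.isZmodClosed.Build (int -> R) ell1_pred ell1_zmod_closed.

End summation_theory.

Record ell1 (R : realType) := Ell1 {
  ell1_fun :> int -> R;
  ell1P : ell1_fun \in ell1_pred }.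

HB.instance Definition _ (R : realType) := [isSub for @ell1_fun R].
HB.instance Definition _ (R : realType) := [Choice of ell1 R by <:].
HB.instance Definition _ (R : realType) := [SubChoice_isSubZmodule of ell1 R by <:].

Section ell1_ring.
Context {R : realType}.
Implicit Types a b c : ell1 R.

Lemma ell1_absum a : absum a. Proof. exact/asboolP/ell1P. Qed.
Hint Resolve ell1_absum : core.

Definition mk_ell1 (f : int -> R) (sf : absum f) : ell1 R :=
  @Ell1 R f (asboolT sf).

Definition ell1_mul a b := mk_ell1 (absum_convol (ell1_absum a) (ell1_absum b)).

Fact ell1_mulA : associative ell1_mul.
Proof. by move=> a b c; apply/val_inj; exact: convolA. Qed.
Fact ell1_mulC : commutative ell1_mul.
Proof. by move=> a b; apply/val_inj; exact: convolC. Qed.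
Fact ell1_mul1 : left_id (mk_ell1 absum_delta0) ell1_mul.
Proof. by move=> a; apply/val_inj; exact: convol1l. Qed.
Fact ell1_mulDl : left_distributive ell1_mul +%R.
Proof. by move=> a b c; apply/val_inj; apply: convolDl; exact: ell1_absum. Qed.
Fact ell1_oner_neq0 : mk_ell1 absum_delta0 != 0 :> ell1 R.
Proof.
apply/negP => /eqP /(congr1 (fun a : ell1 R => a 0)); rewrite /= delta0E eqxx.
exact/eqP/oner_neq0.
Qed.

HB.instance Definition _ := GRing.Zmodule_isComNzRing.Build (ell1 R)
  ell1_mulA ell1_mulC ell1_mul1 ell1_mulDl ell1_oner_neq0.

Definition ell1_scale (r : R) a := mk_ell1 (absumZ r (ell1_absum a)).

Fact ell1_scaleA r s a : ell1_scale r (ell1_scale s a) = ell1_scale (r * s) a.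
Proof. by apply/val_inj/funext => n /=; rewrite mulrA. Qed.
Fact ell1_scale1 : left_id 1 ell1_scale.
Proof. by move=> a; apply/val_inj/funext => n /=; rewrite mul1r. Qed.
Fact ell1_scaleDr : right_distributive ell1_scale +%R.
Proof. by move=> r a b; apply/val_inj/funext => n /=; rewrite mulrDr. Qed.
Fact ell1_scaleDl a : {morph ell1_scale^~ a : r s / r + s}.
Proof. by move=> r s; apply/val_inj/funext => n /=; rewrite mulrDl. Qed.

HB.instance Definition _ := GRing.Zmodule_isLmodule.Build R (ell1 R)
  ell1_scaleA ell1_scale1 ell1_scaleDr ell1_scaleDl.

Fact ell1_scaleAl (r : R) a b : r *: (a * b) = (r *: a) * b.
Proof.
apply/val_inj/funext => k /=; rewrite /convol -sumZZ; last exact: absum_convol_term.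
by apply: eq_sumZ => j; rewrite mulrA.
Qed.

HB.instance Definition _ := GRing.Lmodule_isLalgebra.Build R (ell1 R) ell1_scaleAl.
HB.instance Definition _ := GRing.Lalgebra_isComAlgebra.Build R (ell1 R).

Lemma ell1_ext a b : a =1 b -> a = b.
Proof. by move=> ab; apply/val_inj/funext. Qed.

Lemma ell1M a b k : (a * b) k = convol a b k. Proof. by []. Qed.
Lemma ell1D a b k : (a + b) k = a k + b k. Proof. by []. Qed.
Lemma ell1B a b k : (a - b) k = a k - b k. Proof. by []. Qed.
Lemma ell1Z r a k : (r *: a) k = r * a k. Proof. by []. Qed.
Lemma ell11 k : (1 : ell1 R) k = delta0 k. Proof. by []. Qed.

Lemma ell1X a n : convol_pow a n = (a ^+ n : ell1 R).
Proof.
by elim: n => [|n IHn]//; rewrite exprS /convol_pow iterS -/(convol_pow a n) IHn.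
Qed.

Definition norm1 a : R := \int[counting]_n `|a n|.

Lemma norm1_ge0 a : 0 <= norm1 a. Proof. exact: Rintegral_ge0. Qed.

Lemma le_norm1 a k : `|a k| <= norm1 a. Proof. exact: ler_norm_sum1. Qed.

Lemma norm1D a b : norm1 (a + b) <= norm1 a + norm1 b.
Proof.
rewrite /norm1 -sumZD; [|exact: absum_norm..].
apply: ler_sumZ => [||n]; last exact: ler_normD.
- exact: (absum_norm (ell1_absum (a + b))).
- by apply: absumD; exact: absum_norm.
Qed.

Lemma norm1N a : norm1 (- a) = norm1 a.
Proof. by apply: eq_sumZ => n; rewrite normrN. Qed.

Lemma norm1B a b : norm1 (a - b) <= norm1 a + norm1 b.
Proof. by rewrite -(norm1N b) norm1D. Qed.

Lemma norm1Z r a : norm1 (r *: a) = `|r| * norm1 a.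
Proof.
rewrite /norm1 -sumZZ; last exact: absum_norm.
by apply: eq_sumZ => n; rewrite -normrM.
Qed.

Lemma norm1_0 : norm1 0 = 0.
Proof. by rewrite -(scale0r 0) norm1Z normr0 mul0r. Qed.

Lemma norm1_1 : norm1 1 = 1.
Proof.
rewrite /norm1 (sumZ_single (a := 0)); first by rewrite ell11 delta0E eqxx normr1.
by move=> n /negbTE n0; rewrite ell11 delta0E n0 normr0.
Qed.

(** The total mass is multiplicative on nonnegative sequences, and [|a * b|] is
    dominated by [|a| * |b|]. *)
Lemma norm1M a b : norm1 (a * b) <= norm1 a * norm1 b.
Proof.
pose a' := mk_ell1 (absum_norm (ell1_absum a)).
pose b' := mk_ell1 (absum_norm (ell1_absum b)).
apply: (@le_trans _ _ (\int[counting]_n ((a' * b') n * 1))).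
  apply: ler_sumZ => [||k].
  - exact: (absum_norm (ell1_absum (a * b))).
  - by under [fun=> _]eq_fun do rewrite mulr1.
  rewrite mulr1 !ell1M; apply: le_trans (ler_norm_sumZ _) _.
    exact: absum_convol_term.
  by rewrite le_eqVlt; apply/orP; left; apply/eqP/eq_sumZ => j; rewrite normrM.
rewrite (sumZ_convol (phi := fun=> 1) (M := 1))//; last by rewrite normr1.
under eq_Rintegral do under eq_Rintegral do rewrite mulr1.
under eq_Rintegral do rewrite mulrC.
by rewrite sumZZ// mulrC.
Qed.

Lemma norm1X_le1 a n : norm1 a <= 1 -> norm1 (a ^+ n) <= 1.
Proof.
move=> a1; elim: n => [|n IHn]; first by rewrite norm1_1.
rewrite exprS (le_trans (norm1M _ _))//.
by rewrite (le_trans (ler_pM (norm1_ge0 _) (norm1_ge0 _) a1 IHn))// mulr1.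
Qed.

Lemma norm1_sum I (s : seq I) (P : pred I) (F : I -> ell1 R) :
  norm1 (\sum_(i <- s | P i) F i) <= \sum_(i <- s | P i) norm1 (F i).
Proof.
elim/big_ind2: _ => [|a x b y ax by_|//]; first by rewrite norm1_0.
by rewrite (le_trans (norm1D _ _))// lerD.
Qed.

End ell1_ring.
#[export] Hint Resolve ell1_absum : core.

(** * The Fourier transform *)

Section complex_parts.
Context {R : realType}.
Implicit Types z w : R[i].

Lemma ReD z w : complex.Re (z + w) = complex.Re z + complex.Re w.
Proof. by case: z w => [a b] [c d]. Qed.
Lemma ImD z w : complex.Im (z + w) = complex.Im z + complex.Im w.
Proof. by case: z w => [a b] [c d]. Qed.
Lemma ReN z : complex.Re (- z) = - complex.Re z. Proof. by case: z. Qed.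
Lemma ImN z : complex.Im (- z) = - complex.Im z. Proof. by case: z. Qed.
Lemma ReM z w :
  complex.Re (z * w) = complex.Re z * complex.Re w - complex.Im z * complex.Im w.
Proof. by case: z w => [a b] [c d]. Qed.
Lemma ImM z w :
  complex.Im (z * w) = complex.Re z * complex.Im w + complex.Im z * complex.Re w.
Proof. by case: z w => [a b] [c d]. Qed.

Lemma eq_complexP z w : complex.Re z = complex.Re w ->
  complex.Im z = complex.Im w -> z = w.
Proof. by case: z w => [a b] [c d] /= -> ->. Qed.

End complex_parts.

Section derivative_rules.
Context {R : realType}.
Implicit Types (f g : R -> R) (t : R).

Lemma is_derive_mul f g t df dg : is_derive t 1 f df -> is_derive t 1 g dg ->
  is_derive t 1 (fun x => f x * g x) (df * g t + f t * dg).
Proof.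
move=> Df Dg; apply: (@is_derive_eq _ _ _ (f * g)).
by rewrite addrC [df * _]mulrC.
Qed.

Lemma is_derive_scal c f t df : is_derive t 1 f df ->
  is_derive t 1 (fun x => c * f x) (c * df).
Proof.
move=> Df; apply: is_derive_eq (is_derive_mul (is_derive_cst c t 1) Df) _.
by rewrite mul0r add0r.
Qed.

Lemma is_derive_lin c t : is_derive t 1 (fun x => c * x) c.
Proof. by apply: is_derive_eq (is_derive_scal c (is_derive_id t 1)) _; rewrite mulr1. Qed.

End derivative_rules.

Section fourier_transform.
Context {R : realType}.
Implicit Types (a b L : ell1 R) (t x : R) (n : int).

Lemma norm_cos_le1 (x : R) : `|cos x| <= 1.
Proof. by rewrite ler_norml cos_geN1 cos_le1. Qed.

Lemma norm_sin_le1 (x : R) : `|sin x| <= 1.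
Proof. by rewrite ler_norml sin_geN1 sin_le1. Qed.

Lemma Re_fourier (f : int -> R) t :
  complex.Re (fourier f t) = \int[counting]_n (f n * cos (n%:~R * t)).
Proof. by apply: eq_sumZ => n; rewrite /= mul0r subr0. Qed.

Lemma Im_fourier (f : int -> R) t :
  complex.Im (fourier f t) = \int[counting]_n (f n * sin (n%:~R * t)).
Proof. by apply: eq_sumZ => n; rewrite /= mul0r addr0. Qed.

Lemma absum_cos a t : absum (fun n => a n * cos (n%:~R * t)).
Proof. by apply: (absumMr (M := 1)) => // n; exact: norm_cos_le1. Qed.

Lemma absum_sin a t : absum (fun n => a n * sin (n%:~R * t)).
Proof. by apply: (absumMr (M := 1)) => // n; exact: norm_sin_le1. Qed.

Definition four t a : R[i] := fourier a t.

Fact four_zmod t : zmod_morphism (four t).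
Proof.
move=> a b; apply: eq_complexP.
  rewrite ReD ReN /four !Re_fourier -sumZB; [|exact: absum_cos..].
  by apply: eq_sumZ => n; rewrite ell1B mulrBl.
rewrite ImD ImN /four !Im_fourier -sumZB; [|exact: absum_sin..].
by apply: eq_sumZ => n; rewrite ell1B mulrBl.
Qed.

(** Multiplicativity is the change of variables [sumZ_convol] for [phi] the cosine
    and the sine of [n * t], followed by their addition formulas. *)
Fact four_monoid t : monoid_morphism (four t).
Proof.
split=> [|a b]; apply: eq_complexP.
- rewrite /four Re_fourier (sumZ_single (a := 0)); last first.
    by move=> n /negbTE n0; rewrite ell11 delta0E n0 mul0r.
  by rewrite ell11 delta0E eqxx mul0r cos0 mulr1.
- rewrite /four Im_fourier (sumZ_single (a := 0)); last first.
    by move=> n /negbTE n0; rewrite ell11 delta0E n0 mul0r.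
  by rewrite ell11 delta0E eqxx mul0r sin0 mulr0.
- rewrite (ReM, ImM) /four !(Re_fourier, Im_fourier).
  rewrite (sumZ_convol (phi := fun n => cos (n%:~R * t)) (M := 1))//; last first.
    by move=> n; exact: norm_cos_le1.
  rewrite -RintegralZr//; last exact: absum_cos.
  rewrite -RintegralZr//; last exact: absum_sin.
  rewrite -sumZB.
  + apply: eq_sumZ => j; rewrite -!mulrA -mulrBr; congr (_ * _).
    rewrite -!sumZZ; [|exact: absum_sin|exact: absum_cos].
    rewrite -sumZB; [|exact/absumZ/absum_cos|exact/absumZ/absum_sin].
    by apply: eq_sumZ => l; rewrite intrD mulrDl cosD; ring.
  + by under [fun=> _]eq_fun do rewrite mulrC; apply/absumZ/absum_cos.
  + by under [fun=> _]eq_fun do rewrite mulrC; apply/absumZ/absum_sin.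
- rewrite (ReM, ImM) /four !(Re_fourier, Im_fourier).
  rewrite (sumZ_convol (phi := fun n => sin (n%:~R * t)) (M := 1))//; last first.
    by move=> n; exact: norm_sin_le1.
  rewrite -RintegralZr//; last exact: absum_cos.
  rewrite -RintegralZr//; last exact: absum_sin.
  rewrite -sumZD.
  + apply: eq_sumZ => j; rewrite -!mulrA -mulrDr; congr (_ * _).
    rewrite -!sumZZ; [|exact: absum_cos|exact: absum_sin].
    rewrite -sumZD; [|exact/absumZ/absum_sin|exact/absumZ/absum_cos].
    by apply: eq_sumZ => l; rewrite intrD mulrDl sinD; ring.
  + by under [fun=> _]eq_fun do rewrite mulrC; apply/absumZ/absum_cos.
  + by under [fun=> _]eq_fun do rewrite mulrC; apply/absumZ/absum_sin.
Qed.

HB.instance Definition _ t :=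
  GRing.isZmodMorphism.Build (ell1 R) R[i] (four t) (four_zmod t).
HB.instance Definition _ t :=
  GRing.isMonoidMorphism.Build (ell1 R) R[i] (four t) (four_monoid t).

Lemma fourZ t (r : R) a : four t (r *: a) = r%:C%C * four t a.
Proof.
apply: eq_complexP.
  rewrite ReM mul0r subr0 /four !Re_fourier -sumZZ; last exact: absum_cos.
  by apply: eq_sumZ => n; rewrite mulrA.
rewrite ImM mul0r addr0 /four !Im_fourier -sumZZ; last exact: absum_sin.
by apply: eq_sumZ => n; rewrite mulrA.
Qed.

(** Dominated convergence, [a] itself being the dominating sequence. *)
Lemma continuous_sumZ (a : int -> R) (u : int -> R -> R) : absum a ->
  (forall n, continuous (u n)) -> (forall n t, `|u n t| <= 1) ->
  continuous (fun t => \int[counting]_n (a n * u n t)).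
Proof.
move=> sa cu u1 t.
apply: (@continuity_under_integral R _ int counting
  (fun t n => a n * u n t) setT measurableT (t - 1) (t + 1) _ _ _ (absum_norm sa)).
- move=> x _; exact: (absumMr (M := 1)).
- apply/aeW => n _ x _; apply: (@continuousM _ R^o); [exact: cst_continuous|exact: cu].
- move=> x _; apply/aeW => n _; rewrite normrM -[leRHS]mulr1.
  by rewrite ler_wpM2l.
- by rewrite inE /= in_itv /= ltrBlDr ltrDl ltr01.
Qed.

Lemma continuous_Re_four a : continuous (fun t => complex.Re (four t a)).
Proof.
rewrite (_ : (fun t => _) = (fun t => \int[counting]_n (a n * cos (n%:~R * t)))).
  apply: (continuous_sumZ (u := fun n t => cos (n%:~R * t))) => //.
    move=> n t; apply: (@continuous_comp _ _ _ (fun t => n%:~R * t) cos).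
      by apply: (@continuousM _ R^o); [exact: cst_continuous|exact: id].
    exact: continuous_cos.
  by move=> n t; exact: norm_cos_le1.
by apply/funext => t; exact: Re_fourier.
Qed.

Lemma continuous_Im_four a : continuous (fun t => complex.Im (four t a)).
Proof.
rewrite (_ : (fun t => _) = (fun t => \int[counting]_n (a n * sin (n%:~R * t)))).
  apply: (continuous_sumZ (u := fun n t => sin (n%:~R * t))) => //.
    move=> n t; apply: (@continuous_comp _ _ _ (fun t => n%:~R * t) sin).
      by apply: (@continuousM _ R^o); [exact: cst_continuous|exact: id].
    exact: continuous_sin.
  by move=> n t; exact: norm_sin_le1.
by apply/funext => t; exact: Im_fourier.
Qed.

(** Differentiation under the sum: the derivatives of the terms are dominated by
    [a].  The terms may grow linearly in [t], as is the case of the primitives of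
    [cos (n * t)] for [n = 0]. *)
Lemma is_derive_sumZ (a : int -> R) (u u' : int -> R -> R) t :
  absum a ->
  (forall n x, is_derive x 1 (u n) (u' n x)) ->
  (forall n x, `|u' n x| <= 1) -> (forall n x, `|u n x| <= 1 + `|x|) ->
  is_derive t 1 (fun x => \int[counting]_n (a n * u n x))
                (\int[counting]_n (a n * u' n t)).
Proof.
move=> sa du u'1 uM.
have du2 n x : is_derive x 1 (fun x => a n * u n x) (a n * u' n x).
  by exact: is_derive_scal.
have It : `]t - 1, t + 1[%classic t.
  by rewrite /= in_itv /= ltrBlDr ltrDl ltr01.
have intu x : `]t - 1, t + 1[%classic x ->
    (@counting int R).-integrable setT (EFin \o (fun n => a n * u n x)).
  by move=> _; apply: (absumMr (M := 1 + `|x|)).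
have der x n : `]t - 1, t + 1[%classic x -> [set: int] n ->
    derivable (fun x => a n * u n x) x 1.
  by move=> _ _; case: (du2 n x).
have d1E x n : partial1of2 (fun x n => a n * u n x) x n = a n * u' n x.
  by rewrite partial1of2E; case: (du2 n x).
have Gub x n : `]t - 1, t + 1[%classic x -> [set: int] n ->
    `|partial1of2 (fun x n => a n * u n x) x n| <= `|a n|.
  by move=> _ _; rewrite d1E normrM -[leRHS]mulr1 ler_wpM2l.
have := @derivable_under_integral R _ int counting (fun x n => a n * u n x)
  setT measurableT t (t - 1) (t + 1) It intu der _ (fun=> normr_ge0 _)
  (absum_norm sa) Gub.
have := @differentiation_under_integral R _ int counting (fun x n => a n * u n x)
  setT measurableT t (t - 1) (t + 1) It intu der _ (fun=> normr_ge0 _)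
  (absum_norm sa) Gub.
move=> dE dF; split => //; rewrite -derive1E dE.
by apply: eq_sumZ => n; rewrite d1E.
Qed.

(** The primitive, vanishing at [0], of [t |-> cos (n * t)]. *)
Definition sinc n t : R := if n == 0 then t else sin (n%:~R * t) / n%:~R.

Lemma is_derive_sinc n t : is_derive t 1 (sinc n) (cos (n%:~R * t)).
Proof.
rewrite /sinc; have [->|n0] := eqVneq n 0.
  by rewrite mul0r cos0; exact: is_derive_id.
have n0R : n%:~R != 0 :> R by rewrite intr_eq0.
have D := is_derive1_comp (is_derive_sin (n%:~R * t)) (is_derive_lin n%:~R t).
have := is_derive_scal n%:~R^-1 D.
rewrite mulrCA mulVf// mulr1; congr (is_derive _ _ _ _).
by apply/funext => x; rewrite mulrC.
Qed.

Lemma norm_sinc_le n t : `|sinc n t| <= 1 + `|t|.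
Proof.
rewrite /sinc; have [_|n0] := eqVneq n 0; first by rewrite lerDr.
have n1 : 1 <= `|n%:~R : R| by rewrite -intr_norm ler1z; lia.
rewrite normrM normfV (@le_trans _ _ 1)// ?lerDl// ler_pdivrMr ?mul1r.
  exact: le_trans (norm_sin_le1 _) n1.
exact: lt_le_trans ltr01 n1.
Qed.

(** The primitive of [Re (four t L)], written down term by term.  With it the
    estimates on Fourier coefficients need derivatives only: no function of [t] is
    ever integrated. *)
Definition Re_primitive L t : R := \int[counting]_n (L n * sinc n t).

Lemma is_derive_Re_primitive L t :
  is_derive t 1 (Re_primitive L) (complex.Re (four t L)).
Proof.
rewrite /four Re_fourier; apply: (is_derive_sumZ (u := sinc)
  (u' := fun n t => cos (n%:~R * t))) => // [n x|n x|n x].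
- exact: is_derive_sinc.
- exact: norm_cos_le1.
- exact: norm_sinc_le.
Qed.

Lemma sin_intpi n : sin (n%:~R * pi) = 0 :> R.
Proof.
have sin_natpi (k : nat) : sin (k%:R * pi) = 0 :> R.
  elim: k => [|k IHk]; first by rewrite mul0r sin0.
  by rewrite -natr1 mulrDl mul1r sinDpi IHk oppr0.
case: n => k; first exact: sin_natpi.
by rewrite NegzE rmorphN mulNr sinN sin_natpi oppr0.
Qed.

Lemma Re_primitive0 L : Re_primitive L 0 = 0.
Proof.
rewrite /Re_primitive (eq_sumZ (g := fun=> 0)) ?sumZ0// => n.
by rewrite /sinc; case: ifP => _; rewrite !mulr0// sin0 mul0r mulr0.
Qed.

(** Fourier inversion for real sequences: of all the terms of the primitive, only
    the constant one survives at [pi]. *)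
Lemma Re_primitive_pi L : Re_primitive L pi = pi * L 0.
Proof.
rewrite /Re_primitive (sumZ_single (a := 0)); first by rewrite /sinc eqxx mulrC.
by move=> n /negbTE n0; rewrite /sinc n0 sin_intpi mul0r mulr0.
Qed.

Lemma Im_four0 L : complex.Im (four 0 L) = 0.
Proof.
rewrite /four Im_fourier (eq_sumZ (g := fun=> 0)) ?sumZ0// => n.
by rewrite mulr0 sin0 mulr0.
Qed.

Lemma Im_four_pi L : complex.Im (four pi L) = 0.
Proof.
rewrite /four Im_fourier (eq_sumZ (g := fun=> 0)) ?sumZ0// => n.
by rewrite sin_intpi mulr0.
Qed.

End fourier_transform.

(** * Bounding Fourier coefficients by two derivatives *)

Section calculus.
Context {R : realType}.
Implicit Types (f g : R -> R) (a b s t : R).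

Lemma is_derive_continuous f t df : is_derive t 1 f df -> {for t, continuous f}.
Proof. by move=> [ft _]; apply/differentiable_continuous/derivable1_diffP. Qed.

(** The mean value inequality, with a majorant known only through its
    derivative: no integral of the majorant is ever needed. *)
Lemma ler_norm_sub_deriv f f' g g' a b :
  (forall x, a < x < b -> is_derive x 1 f (f' x)) ->
  (forall x, a < x < b -> is_derive x 1 g (g' x)) ->
  (forall x, a < x < b -> `|f' x| <= g' x) ->
  forall s t, a < s -> s <= t -> t < b -> `|f t - f s| <= g t - g s.
Proof.
move=> Df Dg fg s t as_ st tb.
have mono (F F' : R -> R) : (forall x, a < x < b -> is_derive x 1 F (F' x)) ->
    (forall x, a < x < b -> 0 <= F' x) -> F s <= F t.
  move=> DF F'0; have [->//|s_t] := eqVneq s t.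
  have lt_st : s < t by rewrite lt_neqAle s_t.
  have inab x : x \in `[s, t] -> a < x < b.
    by rewrite in_itv /= => /andP[sx xt]; rewrite (lt_le_trans as_)// (le_lt_trans xt).
  have DFst x : x \in `]s, t[ -> is_derive x 1 F (F' x).
    by move=> xst; apply/DF/inab/subset_itv_oo_cc.
  have cF : {within `[s, t], continuous F}.
    by apply: derivable_within_continuous => x xst; case: (DF x (inab x xst)).
  have [c cst E] := MVT lt_st DFst cF.
  rewrite -subr_ge0 E mulr_ge0 ?subr_ge0//.
  exact/F'0/inab/subset_itv_oo_cc.
rewrite ler_norml; apply/andP; split.
- have := mono (fun x => f x + g x) (fun x => f' x + g' x) _ _.
  have {}D x : a < x < b -> is_derive x 1 (fun x => f x + g x) (f' x + g' x).
    by move=> xab; have ? := Df x xab; have ? := Dg x xab; exact: is_deriveD.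
  move=> /(_ D) H; have {}H : f s + g s <= f t + g t.
    by apply: H => x /fg; rewrite ler_norml => /andP[]; lra.
  lra.
- have := mono (fun x => g x - f x) (fun x => g' x - f' x) _ _.
  have {}D x : a < x < b -> is_derive x 1 (fun x => g x - f x) (g' x - f' x).
    by move=> xab; have ? := Df x xab; have ? := Dg x xab; exact: is_deriveB.
  move=> /(_ D) H; have {}H : g s - f s <= g t - f t.
    by apply: H => x /fg; rewrite ler_norml => /andP[]; lra.
  lra.
Qed.

Lemma exists_near_right f a b (e : R) : a < b -> {for a, continuous f} -> 0 < e ->
  exists2 s, a < s < b & `|f a - f s| < e.
Proof.
move=> ab /cvgrPdist_lt /(_ e) cf e0.
have [d /= d0 dP] := cf e0.
pose s := a + Num.min (d / 2) ((b - a) / 2).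
have m0 : 0 < Num.min (d / 2) ((b - a) / 2) by rewrite lt_min; lra.
have md : Num.min (d / 2) ((b - a) / 2) <= d / 2 by rewrite ge_min lexx.
have mb : Num.min (d / 2) ((b - a) / 2) <= (b - a) / 2 by rewrite ge_min lexx orbT.
exists s; first by rewrite /s; apply/andP; split; lra.
by apply: dP => /=; rewrite /s opprD addrA subrr add0r normrN gtr0_norm//; lra.
Qed.

Lemma exists_near_left f a b (e : R) : a < b -> {for b, continuous f} -> 0 < e ->
  exists2 t, a < t < b & `|f b - f t| < e.
Proof.
move=> ab /cvgrPdist_lt /(_ e) cf e0.
have [d /= d0 dP] := cf e0.
pose m := Num.min (d / 2) ((b - a) / 2).
have m0 : 0 < m by rewrite lt_min; lra.
have md : m <= d / 2 by rewrite ge_min lexx.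
have mb : m <= (b - a) / 2 by rewrite ge_min lexx orbT.
exists (b - m); first by apply/andP; split; lra.
by apply: dP => /=; rewrite opprB addrCA subrr addr0 gtr0_norm//; lra.
Qed.

(** The derivative bounds are available on an open interval only; continuity
    carries the resulting increment bounds to its endpoints. *)
Lemma ler_norm_sub_endpoints f a b (C : R) : a < b ->
  {for a, continuous f} -> {for b, continuous f} ->
  (forall s t, a < s -> s <= t -> t < b -> `|f t - f s| <= C) ->
  `|f b - f a| <= C.
Proof.
move=> ab ca cb fC; apply/ler_addgt0Pr => e e0.
have e2 : 0 < e / 2 by rewrite divr_gt0.
have [t /andP[at_ tb] ft] := exists_near_left ab cb e2.
have [s /andP[as_ st] fs] := exists_near_right at_ ca e2.
have := fC s t as_ (ltW st) tb.
have -> : f b - f a = (f b - f t) + (f t - f s) - (f a - f s) by ring.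
move=> fts; rewrite (le_trans (ler_normB _ _))//.
have := ler_normD (f b - f t) (f t - f s); lra.
Qed.

End calculus.

Section complex_calculus.
Context {R : realType}.
Implicit Types (F G : R -> R[i]) (t : R) (z w : R[i]).
Local Notation normc := Normc.normc.

Lemma norm_Re_le z : `|complex.Re z| <= normc z.
Proof.
case: z => a b /=; rewrite -sqrtr_sqr ler_sqrt ?lerDl ?sqr_ge0//.
by rewrite addr_ge0 ?sqr_ge0.
Qed.

Lemma norm_Im_le z : `|complex.Im z| <= normc z.
Proof.
case: z => a b /=; rewrite -sqrtr_sqr ler_sqrt ?lerDr ?sqr_ge0//.
by rewrite addr_ge0 ?sqr_ge0.
Qed.

Lemma normc_le_Re_Im z : normc z <= `|complex.Re z| + `|complex.Im z|.
Proof.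
case: z => a b /=; rewrite -[leRHS]ger0_norm ?addr_ge0// -sqrtr_sqr ler_sqrt ?sqr_ge0//.
rewrite sqrrD !real_normK ?num_real// -addrA lerD2l lerDr.
by rewrite mulrn_wge0// mulr_ge0.
Qed.

Lemma normc_ge0 z : 0 <= normc z. Proof. by case: z => a b; exact: sqrtr_ge0. Qed.

Lemma normc_real (r : R) : normc r%:C%C = `|r|.
Proof. by rewrite /= expr0n addr0 sqrtr_sqr. Qed.

Lemma normcD z w : normc (z + w) <= normc z + normc w.
Proof. by rewrite -lecR rmorphD; exact: (ler_normD z w). Qed.

Lemma normcD4 (x y z w : R[i]) :
  normc (x + y + (z + w)) <= normc x + normc y + (normc z + normc w).
Proof. by rewrite (le_trans (normcD _ _))// lerD// normcD. Qed.

Lemma normcX z n : normc (z ^+ n) = normc z ^+ n.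
Proof.
elim: n => [|n IHn]; first by rewrite !expr0 Normc.normc1.
by rewrite !exprS Normc.normcM IHn.
Qed.

Definition cder F t (l : R[i]) :=
  is_derive t 1 (fun x => complex.Re (F x)) (complex.Re l) /\
  is_derive t 1 (fun x => complex.Im (F x)) (complex.Im l).

Lemma cder_cst z t : cder (fun=> z) t 0.
Proof. by split; exact: is_derive_cst. Qed.

Lemma cderD F G t (F' G' : R[i]) : cder F t F' -> cder G t G' ->
  cder (fun x => F x + G x) t (F' + G').
Proof.
move=> [FR FI] [GR GI]; split.
  rewrite (_ : (fun x => _) = (fun x => complex.Re (F x) + complex.Re (G x))).
    by rewrite ReD; exact: is_deriveD.
  by apply/funext => x; exact: ReD.
rewrite (_ : (fun x => _) = (fun x => complex.Im (F x) + complex.Im (G x))).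
  by rewrite ImD; exact: is_deriveD.
by apply/funext => x; exact: ImD.
Qed.

Lemma cderM F G t (F' G' : R[i]) : cder F t F' -> cder G t G' ->
  cder (fun x => F x * G x) t (F' * G t + F t * G').
Proof.
move=> [FR FI] [GR GI]; split.
  rewrite (_ : (fun x => _) = (fun x => complex.Re (F x) * complex.Re (G x)
      - complex.Im (F x) * complex.Im (G x))); last first.
    by apply/funext => x; exact: ReM.
  rewrite ReD !ReM.
  apply: is_derive_eq (is_deriveB (is_derive_mul FR GR) (is_derive_mul FI GI)) _.
  by ring.
rewrite (_ : (fun x => _) = (fun x => complex.Re (F x) * complex.Im (G x)
    + complex.Im (F x) * complex.Re (G x))); last first.
  by apply/funext => x; exact: ImM.
rewrite ImD !ImM.
apply: is_derive_eq (is_deriveD (is_derive_mul FR GI) (is_derive_mul FI GR)) _.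
by ring.
Qed.

Lemma cder_eq F t (l l' : R[i]) : cder F t l -> l = l' -> cder F t l'.
Proof. by move=> ? <-. Qed.

Lemma cderX F t (F' : R[i]) n : cder F t F' ->
  cder (fun x => F x ^+ n) t (n%:R * F t ^+ n.-1 * F').
Proof.
move=> DF; elim: n => [|n IHn].
  by rewrite mul0r mul0r; exact: cder_cst.
have := cderM DF IHn; under eq_fun do rewrite -exprS.
move/cder_eq; apply; rewrite -natr1 /=; case: n {IHn} => [|n] /=.
  by rewrite !expr0; ring.
by rewrite exprS; ring.
Qed.

(** The character [t |-> exp (- i x t)]. *)
Definition expi (x : R) (t : R) : R[i] := (cos (x * t) -i* sin (x * t))%C.

Lemma normc_expi (x t : R) : normc (expi x t) = 1.
Proof. by rewrite /= sqrrN cos2Dsin2 sqrtr1. Qed.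

Lemma cder_expi (x t : R) : cder (expi x) t (- (0 +i* x)%C * expi x t).
Proof.
have Dx := is_derive_lin x t; split => /=.
  have := is_derive1_comp (is_derive_cos (x * t)) Dx.
  move/is_derive_eq; apply; ring.
have := is_deriveN (is_derive1_comp (is_derive_sin (x * t)) Dx).
move/is_derive_eq; apply; ring.
Qed.

End complex_calculus.

Section coefficient_bound.
Context {R : realType}.
Local Notation normc := Normc.normc.

Definition ell1_shift (k : int) (a : ell1 R) : ell1 R :=
  mk_ell1 (absum_shift k (ell1_absum a)).

Lemma ell1_shiftE k a n : ell1_shift k a n = a (n + k). Proof. by []. Qed.

(** Translating the sequence multiplies the transform by a character; hence a bound
    on the coefficient at [0] is a bound on all coefficients. *)
Lemma four_shift k (a : ell1 R) t :
  four t (ell1_shift k a) = four t a * expi k%:~R t.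
Proof.
have sc := absum_cos a t; have ss := absum_sin a t.
have e (b : int -> R) (u : int -> R) : absum (fun n => b n * u (n - k)) ->
    \int[counting]_n (b ((n : int) + k) * u n) = \int[counting]_n (b n * u ((n : int) - k)).
  move=> su; rewrite -(sumZ_shift k su).
  by apply: eq_sumZ => n; rewrite addrK.
apply: eq_complexP.
  rewrite ReM /four !(Re_fourier, Im_fourier) /= mulrN opprK.
  rewrite (e a (fun n => cos (n%:~R * t))); last first.
    by apply: (absumMr (M := 1)) => // n; exact: norm_cos_le1.
  rewrite -!RintegralZr// -sumZD; [|exact: (integrableZr _ _ sc)..|exact: (integrableZr _ _ ss)].
  by apply: eq_sumZ => n; rewrite intrB mulrBl cosB; ring.
rewrite ImM /four !(Re_fourier, Im_fourier) /= mulrN addrC.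
rewrite (e a (fun n => sin (n%:~R * t))); last first.
  by apply: (absumMr (M := 1)) => // n; exact: norm_sin_le1.
rewrite -!RintegralZr// -sumZB; [|exact: (integrableZr _ _ ss)|exact: (integrableZr _ _ sc)].
by apply: eq_sumZ => n; rewrite intrB mulrBl sinB; ring.
Qed.

(** Two integrations by parts.  Let [G] be the transform of [K], put
    [E t = exp (- i x t)], and let [P] be the primitive of [Re (G * E)] vanishing at [0]; then the derivative of
    [P + Im (G * E) / x - Re (G1 * E) / x ^+ 2] is [- Re (G2 * E) / x ^+ 2].
    Fourier inversion gives [P pi = pi * K x], and [Im (G * E)] vanishes at both
    endpoints because [K] is real. *)
Lemma coef_bound (K : ell1 R) (G1 G2 : R -> R[i]) (B B' : R -> R) (A D : R) (x : int) :
  x != 0 ->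
  (forall t : R, 0 < t < pi -> cder (fun s => four s K) t (G1 t)) ->
  (forall t : R, 0 < t < pi -> cder G1 t (G2 t)) ->
  (forall t : R, 0 < t < pi -> normc (G1 t) <= A) ->
  (forall t : R, 0 < t < pi -> is_derive t 1 B (B' t)) ->
  (forall t : R, 0 < t < pi -> normc (G2 t) <= B' t) ->
  (forall s t : R, 0 < s -> s <= t -> t < pi -> B t - B s <= D) ->
  `|K x| <= (D + 2 * A) / (pi * x%:~R ^+ 2).
Proof.
move=> x0 DG DG1 G1A DB G2B BD.
have X0 : x%:~R != 0 :> R by rewrite intr_eq0.
set X : R := x%:~R in X0 *; have X2 : 0 < X ^+ 2 by rewrite exprn_even_gt0.
have iX2 : 0 <= X ^- 2 by rewrite invr_ge0 ltW.
pose L := ell1_shift x K.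
pose M t := Re_primitive L t + X^-1 * complex.Im (four t L)
             - X ^- 2 * complex.Re (G1 t * expi X t).
pose N t := Re_primitive L t + X^-1 * complex.Im (four t L).
have fourL s : four s L = four s K * expi X s by exact: four_shift.
have DM t : 0 < t < pi ->
    is_derive t 1 M (- (X ^- 2 * complex.Re (G2 t * expi X t))).
  move=> t0pi; have [_ DI] := cderM (DG t t0pi) (cder_expi X t).
  have [DR _] := cderM (DG1 t t0pi) (cder_expi X t).
  have DMt := is_deriveB (is_deriveD (is_derive_Re_primitive L t)
    (is_derive_scal X^-1 DI)) (is_derive_scal (X ^- 2) DR).
  have -> : M = fun s => Re_primitive L s + X^-1 * complex.Im (four s K * expi X s)
      - X ^- 2 * complex.Re (G1 s * expi X s).
    by apply/funext => s; rewrite /M fourL.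
  apply: is_derive_eq DMt _; rewrite fourL.
  rewrite !(ReD, ImD, ReM, ImM, ReN, ImN) /=.
  by field.
have MB s t : 0 < s -> s <= t -> t < pi -> `|M t - M s| <= X ^- 2 * B t - X ^- 2 * B s.
  apply: (ler_norm_sub_deriv (g := fun t => X ^- 2 * B t) DM).
    by move=> u u0; apply: is_derive_scal; exact: DB.
  move=> u u0 /=; rewrite normrN normrM (ger0_norm iX2).
  rewrite (ler_wpM2l iX2)// (le_trans (norm_Re_le _))//.
  by rewrite Normc.normcM normc_expi mulr1 G2B.
have G1e t : 0 < t < pi -> `|X ^- 2 * complex.Re (G1 t * expi X t)| <= X ^- 2 * A.
  move=> t0; rewrite normrM (ger0_norm iX2).
  rewrite (ler_wpM2l iX2)// (le_trans (norm_Re_le _))//.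
  by rewrite Normc.normcM normc_expi mulr1 G1A.
have NB s t : 0 < s -> s <= t -> t < pi -> `|N t - N s| <= X ^- 2 * (D + 2 * A).
  move=> s0 st tpi.
  have -> : N t - N s = (M t - M s) + (X ^- 2 * complex.Re (G1 t * expi X t)
       - X ^- 2 * complex.Re (G1 s * expi X s)) by rewrite /M /N; ring.
  rewrite (le_trans (ler_normD _ _))// mulrDr lerD//.
    rewrite (le_trans (MB _ _ s0 st tpi))// -mulrBr.
    by rewrite (ler_wpM2l iX2)// BD.
  rewrite (le_trans (ler_normB _ _))//.
  have := G1e t; have := G1e s; rewrite s0 tpi (lt_le_trans s0 st) (le_lt_trans st tpi).
  by move=> /(_ isT) ? /(_ isT) ?; lra.
have cN t : {for t, continuous N}.
  apply: continuousD; first exact: is_derive_continuous (is_derive_Re_primitive L t).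
  by apply: continuousM; [exact: cst_continuous|exact: continuous_Im_four].
have := ler_norm_sub_endpoints (pi_gt0 R) (cN 0) (cN pi) NB.
rewrite /N (Re_primitive0 L) (Re_primitive_pi L) (Im_four0 L) (Im_four_pi L) mulr0 !addr0 subr0.
rewrite ell1_shiftE add0r normrM gtr0_norm ?pi_gt0// => H.
have pX : 0 < pi * X ^+ 2 by rewrite mulr_gt0 ?pi_gt0.
by rewrite (ler_pdivlMr _ _ pX) mulrA -ler_pdivlMr// mulrC [leRHS]mulrC.
Qed.

End coefficient_bound.

(** * Regularity of the kernels under the spectral hypothesis *)

Section exp_weights.
Context {R : realType}.
Implicit Types x y d : R.

Lemma le_expR x : x <= expR x.
Proof. by have := @expR_ge1Dx R x; lra. Qed.

(** A linear factor costs half of the exponential decay. *)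
Lemma mulr_expRN_le d y : 0 < d -> 0 <= y ->
  y * expR (- (d * y)) <= 2 / d * expR (- (d / 2 * y)).
Proof.
move=> d0 y0.
have -> : expR (- (d * y)) = expR (- (d / 2 * y)) * expR (- (d / 2 * y)).
  by rewrite -expRD; congr expR; field.
rewrite mulrA ler_wpM2r ?expR_ge0// expRN -[y * _]/(y / _) ler_pdivrMr ?expR_gt0//.
have := le_expR (d / 2 * y); rewrite -ler_pdivrMl ?divr_gt0//.
by rewrite invf_div.
Qed.

Lemma ler_expRN d y : 0 < d -> 0 <= y -> expR (- (d * y)) <= expR (- (d / 2 * y)).
Proof. by move=> d0 y0; rewrite ler_expR lerN2 ler_wpM2r//; lra. Qed.

End exp_weights.

Section controlled.
Context {R : realType}.
Local Notation normc := Normc.normc.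
Variables (psi' : R -> R) (N : R).
Hypothesis psi'_ge0 : forall t : R, 0 < t < pi -> 0 <= psi' t.
Hypothesis N_ge0 : 0 <= N.

(** First and second derivatives of [F] on [(0, pi)] and the bounds they obey with
    weight [w].  The shape of the bounds is stable under products, so that only
    the powers of the transform and [n (1 - h)] have to be estimated by hand. *)
Definition controlled (w : R -> R) (F F1 F2 : R -> R[i]) :=
  forall t : R, 0 < t < pi ->
    [/\ cder F t (F1 t), cder F1 t (F2 t) &
     [/\ normc (F t) <= w t, normc (t%:C%C * F1 t) <= w t,
         normc (F1 t) <= N * psi' t * w t &
         normc (t%:C%C * F2 t) <= N * psi' t * w t]].

Lemma controlled_le w w' F F1 F2 : (forall t : R, 0 < t < pi -> w t <= w' t) ->
  controlled w F F1 F2 -> controlled w' F F1 F2.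
Proof.
move=> ww' FC t t0; have [D1 D2 [B0 B1 B2 B3]] := FC t t0; have := ww' t t0.
have NP : 0 <= N * psi' t by rewrite mulr_ge0// psi'_ge0.
move=> wt; split=> //; split.
- exact: le_trans wt.
- exact: le_trans wt.
- by rewrite (le_trans B2)// ler_wpM2l.
- by rewrite (le_trans B3)// ler_wpM2l.
Qed.

(** Leibniz' rule.  The second derivative is bounded after multiplication by [t]
    only; in its cross terms this [t] goes to one of the two first derivatives, so
    that a single factor [psi'] comes out.  The constant [4] counts its terms. *)
Lemma controlledM w v F F1 F2 G G1 G2 :
  controlled w F F1 F2 -> controlled v G G1 G2 ->
  controlled (fun t => 4 * (w t * v t)) (fun t => F t * G t)
    (fun t => F1 t * G t + F t * G1 t)
    (fun t => F2 t * G t + F1 t * G1 t + (F1 t * G1 t + F t * G2 t)).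
Proof.
move=> FC GC t t0.
have [D1 D2 [B0 B1 B2 B3]] := FC t t0.
have [E1 E2 [C0 C1 C2 C3]] := GC t t0.
have P0 : 0 <= N * psi' t by rewrite mulr_ge0// psi'_ge0.
have w0 : 0 <= w t := le_trans (normc_ge0 _) B0.
have v0 : 0 <= v t := le_trans (normc_ge0 _) C0.
have wv0 := mulr_ge0 w0 v0.
have Pwv0 := mulr_ge0 P0 wv0.
split; [exact: cderM|by apply: cderD; exact: cderM|].
split.
- rewrite Normc.normcM.
  by have := ler_pM (normc_ge0 _) (normc_ge0 _) B0 C0; lra.
- rewrite mulrDr (le_trans (normcD _ _))// mulrA [_%:C%C * (F t * _)]mulrCA.
  rewrite (Normc.normcM _ (G t)) (Normc.normcM (F t)).
  have := ler_pM (normc_ge0 _) (normc_ge0 _) B0 C1.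
  by have := ler_pM (normc_ge0 _) (normc_ge0 _) B1 C0; lra.
- rewrite (le_trans (normcD _ _))// !Normc.normcM.
  have := ler_pM (normc_ge0 _) (normc_ge0 _) B0 C2.
  by have := ler_pM (normc_ge0 _) (normc_ge0 _) B2 C0; nra.
- have -> : t%:C%C * (F2 t * G t + F1 t * G1 t + (F1 t * G1 t + F t * G2 t)) =
    (t%:C%C * F2 t) * G t + (t%:C%C * F1 t) * G1 t +
    ((t%:C%C * F1 t) * G1 t + F t * (t%:C%C * G2 t)) by ring.
  rewrite (le_trans (normcD4 _ _ _ _))// !(Normc.normcM _ (G t)) !(Normc.normcM _ (G1 t)).
  rewrite (Normc.normcM (F t)).
  have := ler_pM (normc_ge0 _) (normc_ge0 _) B3 C0.
  have := ler_pM (normc_ge0 _) (normc_ge0 _) B1 C2.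
  have := ler_pM (normc_ge0 _) (normc_ge0 _) B0 C3.
  move: (normc _) (normc _) => *; lra.
Qed.

End controlled.

Section kernels.
Context {R : realType}.
Local Notation normc := Normc.normc.
Variables (psi psi' : R -> R) (c C : R) (h h1 h2 : R -> R[i]).
Hypotheses (c0 : 0 < c) (C0 : 0 < C).
Hypothesis Dh : forall t : R, 0 < t < pi -> cder h t (h1 t) /\ cder h1 t (h2 t).
Hypothesis hB : forall t : R, 0 < t < pi ->
  [/\ normc (h t) <= 1 - c * psi t, normc (t%:C%C * h1 t) <= C * psi t,
      normc (h1 t) <= C * psi' t & normc (t%:C%C * h2 t) <= C * psi' t].
Hypothesis hB1 : forall t : R, 0 < t < pi -> normc (1 - h t) <= 2 * C * psi t.

Lemma psi_ge0 t : 0 < t < pi -> 0 <= psi t.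
Proof.
move=> /hB[_ B _ _].
by rewrite -(pmulr_rge0 _ C0) (le_trans (normc_ge0 _) B).
Qed.

Lemma psi'_ge0 t : 0 < t < pi -> 0 <= psi' t.
Proof.
move=> /hB[_ _ B _].
by rewrite -(pmulr_rge0 _ C0) (le_trans (normc_ge0 _) B).
Qed.

(** From [1 - y <= exp (- y)].  The [j] factors that differentiation removes cost
    at most [exp j] because [c * psi t <= 1]; the subtraction being truncated, the
    factor [exp j] also covers the case [n < j]. *)
Lemma normc_powB t (n j : nat) : 0 < t < pi ->
  normc (h t ^+ (n - j)) <= expR j%:R * expR (- (c * (n%:R * psi t))).
Proof.
move=> t0; have [B _ _ _] := hB t0; have p0 := psi_ge0 t0.
have cp1 : c * psi t <= 1 by have := normc_ge0 (h t); lra.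
rewrite normcX (@le_trans _ _ (expR (- (c * psi t)) ^+ (n - j)))//.
  rewrite lerXn2r ?nnegrE ?normc_ge0 ?expR_ge0// (le_trans B)//.
  by have := expR_ge1Dx (- (c * psi t)); lra.
rewrite -expRM_natl -expRD ler_expR -mulr_natl mulrN.
have : (n%:R : R) <= (n - j)%:R + j%:R by rewrite -natrD ler_nat; lia.
have : 0 <= (j%:R : R) by rewrite ler0n.
have := mulr_ge0 (ltW c0) p0.
move: (n%:R : R) ((n - j)%:R : R) (j%:R : R) => a b d cp d0 abd.
have := mulr_ge0 cp (_ : 0 <= b + d - a); have := mulr_ge0 d0 (_ : 0 <= 1 - c * psi t).
by move=> /(_ ltac:(lra)) ? /(_ ltac:(lra)) ?; nra.
Qed.

Definition pow_const : R := 1 + expR 1 * C + expR 1 * C * (2 / c)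
  + expR 2 * C ^+ 2 * (2 / c).

(** In the derivatives of [h ^ n], each factor [n * psi] produced by [t * h'] is
    absorbed by half of the exponential decay of [h ^ (n - j)]. *)
Lemma controlled_pow (n : nat) : (0 < n)%N ->
  controlled psi' n%:R (fun t => pow_const * expR (- (c / 2 * (n%:R * psi t))))
    (fun t => h t ^+ n) (fun t => n%:R * h t ^+ n.-1 * h1 t)
    (fun t => n%:R * (n.-1%:R * h t ^+ n.-2 * h1 t) * h1 t
              + n%:R * h t ^+ n.-1 * h2 t).
Proof.
move=> n0 t t0.
have [D1 D2] := Dh t0; have [_ B1 B2 B3] := hB t0.
have p0 := psi_ge0 t0; have q0 := psi'_ge0 t0.
have n1 : 0 <= (n%:R : R) by rewrite ler0n.
set E := expR _; have E0 : 0 <= E := expR_ge0 _.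
set y := n%:R * psi t in E E0 *; have y0 : 0 <= y by rewrite mulr_ge0.
have H0 : normc (h t ^+ n) <= E.
  have := normc_powB n 0 t0; rewrite subn0 expR0 mul1r => /le_trans; apply.
  exact: ler_expRN.
have H1 : normc (h t ^+ n.-1) <= expR 1 * expR (- (c * y)).
  by have := normc_powB n 1 t0; rewrite subn1.
have H2 : normc (h t ^+ n.-2) <= expR 2 * expR (- (c * y)).
  by have := normc_powB n 2 t0; rewrite subn2.
have cE := ler_expRN c0 y0; have cyE := mulr_expRN_le c0 y0.
rewrite -/E in cE cyE.
have e1 : 0 <= expR 1 :> R := expR_ge0 1; have e2 : 0 <= expR 2 :> R := expR_ge0 2.
have k0 : 0 <= 2 / c by rewrite divr_ge0// ltW.
have Ec0 := expR_ge0 (- (c * y)).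
have A0 : 0 <= expR 1 * C by rewrite mulr_ge0// ltW.
have A1 : 0 <= expR 1 * C * (2 / c) by rewrite mulr_ge0.
have A2 : 0 <= expR 2 * C ^+ 2 * (2 / c).
  by rewrite mulr_ge0// mulr_ge0// exprn_ge0// ltW.
have nn : normc n%:R = n%:R :> R.
  by rewrite -(rmorph_nat (real_complex R)) normc_real ger0_norm.
have nn1 : normc n.-1%:R <= n%:R :> R.
  rewrite -(rmorph_nat (real_complex R)) normc_real ger0_norm ?ler0n//.
  by rewrite ler_nat leq_pred.
have PC : pow_const * E = E + expR 1 * C * E + expR 1 * C * (2 / c) * E
    + expR 2 * C ^+ 2 * (2 / c) * E by rewrite /pow_const; ring.
have := mulr_ge0 A0 E0; have := mulr_ge0 A1 E0; have := mulr_ge0 A2 E0.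
move=> T2 T1 T0.
split.
- exact: cderX.
- have cn : cder (fun s => n%:R * h s ^+ n.-1) t (n%:R * (n.-1%:R * h t ^+ n.-2 * h1 t)).
    have := cderM (cder_cst n%:R t) (cderX n.-1 D1).
    by move/cder_eq; apply; rewrite mul0r add0r.
  exact: cderM cn D2.
- split.
  + by rewrite PC; lra.
  + have -> : t%:C%C * (n%:R * h t ^+ n.-1 * h1 t)
        = n%:R * (h t ^+ n.-1 * (t%:C%C * h1 t)) by ring.
    rewrite (Normc.normcM n%:R) nn Normc.normcM.
    have := ler_wpM2l n1 (ler_pM (normc_ge0 _) (normc_ge0 _) H1 B1).
    have := ler_wpM2l A0 cyE.
    have -> : n%:R * (expR 1 * expR (- (c * y)) * (C * psi t))
        = expR 1 * C * (y * expR (- (c * y))) by rewrite /y; ring.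
    by rewrite PC; lra.
  + rewrite !Normc.normcM nn.
    have P0 : 0 <= n%:R * psi' t by rewrite mulr_ge0.
    have := ler_wpM2l n1 (ler_pM (normc_ge0 _) (normc_ge0 _) H1 B2).
    have := ler_wpM2l P0 (ler_wpM2l A0 cE).
    have -> : n%:R * (expR 1 * expR (- (c * y)) * (C * psi' t))
        = n%:R * psi' t * (expR 1 * C * expR (- (c * y))) by ring.
    have : n%:R * psi' t * (expR 1 * C * E) <= n%:R * psi' t * (pow_const * E).
      by rewrite ler_wpM2l// PC; lra.
    by rewrite mulrA; lra.
  + have P0 : 0 <= n%:R * psi' t by rewrite mulr_ge0.
    have -> : t%:C%C * (n%:R * (n.-1%:R * h t ^+ n.-2 * h1 t) * h1 t
                        + n%:R * h t ^+ n.-1 * h2 t)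
       = n%:R * (n.-1%:R * (h t ^+ n.-2 * ((t%:C%C * h1 t) * h1 t)))
         + n%:R * (h t ^+ n.-1 * (t%:C%C * h2 t)) by ring.
    rewrite (le_trans (normcD _ _))// !(Normc.normcM n%:R) nn (Normc.normcM n.-1%:R).
    rewrite !(Normc.normcM (h t ^+ _)) (Normc.normcM _ (h1 t)).
    have := ler_wpM2l n1 (ler_pM (normc_ge0 _)
      (mulr_ge0 (normc_ge0 _) (mulr_ge0 (normc_ge0 _) (normc_ge0 _))) nn1
      (ler_pM (normc_ge0 _) (mulr_ge0 (normc_ge0 _) (normc_ge0 _)) H2
      (ler_pM (normc_ge0 _) (normc_ge0 _) B1 B2))).
    have := ler_wpM2l n1 (ler_pM (normc_ge0 _) (normc_ge0 _) H1 B3).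
    have A3 : 0 <= expR 2 * C ^+ 2 by rewrite mulr_ge0// exprn_ge0// ltW.
    have := ler_wpM2l P0 (lerD (ler_wpM2l A3 cyE) (ler_wpM2l A0 cE)).
    have -> : n%:R * (n%:R * (expR 2 * expR (- (c * y)) * (C * psi t * (C * psi' t))))
      = n%:R * psi' t * (expR 2 * C ^+ 2 * (y * expR (- (c * y)))) by rewrite /y; ring.
    have -> : n%:R * (expR 1 * expR (- (c * y)) * (C * psi' t))
      = n%:R * psi' t * (expR 1 * C * expR (- (c * y))) by ring.
    have : n%:R * psi' t * (expR 2 * C ^+ 2 * (2 / c * E) + expR 1 * C * E)
         <= n%:R * psi' t * (pow_const * E).
      by rewrite ler_wpM2l// PC; lra.
    by rewrite mulrDr; lra.
Qed.

Lemma controlled_sub1 (n : nat) : (0 < n)%N ->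
  controlled psi' n%:R (fun t => 2 * C * (1 + n%:R * psi t))
    (fun t => n%:R * (1 - h t)) (fun t => - (n%:R * h1 t)) (fun t => - (n%:R * h2 t)).
Proof.
move=> n0 t t0.
have [D1 D2] := Dh t0; have [_ B1 B2 B3] := hB t0; have B0 := hB1 t0.
have p0 := psi_ge0 t0; have q0 := psi'_ge0 t0.
have n1 : 0 <= (n%:R : R) by rewrite ler0n.
have nn : normc n%:R = n%:R :> R.
  by rewrite -(rmorph_nat (real_complex R)) normc_real ger0_norm.
have np : 0 <= n%:R * psi t by rewrite mulr_ge0.
have P0 : 0 <= n%:R * psi' t by rewrite mulr_ge0.
have Cnp : 0 <= C * (n%:R * psi t) by rewrite mulr_ge0// ltW.
have CP0 : 0 <= C * (n%:R * psi' t) by rewrite mulr_ge0// ltW.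
have CPP : 0 <= (n%:R * psi' t) * (C * (n%:R * psi t)) by rewrite mulr_ge0.
have nM1 (z : R[i]) : normc (- z) = normc z.
  by rewrite -mulN1r Normc.normcM -(rmorphN1 (real_complex R)) normc_real normrN1 mul1r.
split.
- have D := cderM (cder_cst n%:R t) (cderD (cder_cst 1 t) (cderM (cder_cst (-1) t) D1)).
  have -> : (fun t => n%:R * (1 - h t)) = (fun t => n%:R * (1 + -1 * h t)).
    by apply/funext => s; rewrite mulN1r.
  by apply: cder_eq D _; ring.
- have D := cderM (cder_cst (- n%:R) t) D2.
  have -> : (fun t => - (n%:R * h1 t)) = (fun t => - n%:R * h1 t).
    by apply/funext => s; rewrite mulNr.
  by apply: cder_eq D _; ring.
split.
- rewrite Normc.normcM nn; have := ler_wpM2l n1 B0.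
  by have := C0; lra.
- rewrite mulrN nM1 mulrCA (Normc.normcM n%:R) nn; have := ler_wpM2l n1 B1.
  by have := C0; lra.
- rewrite nM1 Normc.normcM nn; have := ler_wpM2l n1 B2.
  by lra.
- rewrite mulrN nM1 mulrCA (Normc.normcM n%:R) nn; have := ler_wpM2l n1 B3.
  by lra.
Qed.

(** Induction on [m]: the factor [n * (1 - h)] has weight [1 + n * psi], which costs
    half of the exponential decay, so [d] depends on [m] but not on [n]. *)
Lemma controlled_kernel (m : nat) : exists A d : R, [/\ 0 < A, 0 < d &
  forall n : nat, (0 < n)%N -> exists F1 F2,
    controlled psi' n%:R (fun t => A * expR (- (d * (n%:R * psi t))))
      (fun t => n%:R ^+ m * (h t ^+ n * (1 - h t) ^+ m)) F1 F2].
Proof.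
elim: m => [|m [A [d [A0 d0 AdP]]]].
  exists pow_const, (c / 2); split; [|by rewrite divr_gt0|].
    rewrite /pow_const; have : 0 < expR 1 * C by rewrite mulr_gt0 ?expR_gt0.
    have : 0 < expR 1 * C * (2 / c) by rewrite !mulr_gt0 ?expR_gt0 ?invr_gt0.
    have : 0 < expR 2 * C ^+ 2 * (2 / c) by rewrite !mulr_gt0 ?expR_gt0 ?invr_gt0 ?exprn_gt0.
    by lra.
  move=> n n0; do 2 eexists; have := controlled_pow n0.
  rewrite [X in controlled _ _ _ X](_ : _ =
    (fun t => n%:R ^+ 0 * (h t ^+ n * (1 - h t) ^+ 0))); first exact.
  by apply/funext => t; rewrite !expr0 mul1r mulr1.
have k0 : 0 < 1 + 2 / d by rewrite addr_gt0// divr_gt0.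
exists (4 * (A * (2 * C) * (1 + 2 / d))), (d / 2); split.
- by rewrite !mulr_gt0.
- by rewrite divr_gt0.
move=> n n0; have [F1 [F2 FC]] := AdP n n0.
have n1 : 0 <= (n%:R : R) by rewrite ler0n.
do 2 eexists.
have := controlledM psi'_ge0 n1 FC (controlled_sub1 n0).
rewrite [X in controlled _ _ _ X](_ : _ =
    (fun t => n%:R ^+ m.+1 * (h t ^+ n * (1 - h t) ^+ m.+1))); last first.
  by apply/funext => t; rewrite !exprS; ring.
apply: controlled_le; [exact: psi'_ge0|exact: n1|move=> t t0 /=].
have y0 : 0 <= n%:R * psi t by rewrite mulr_ge0// psi_ge0.
have := lerD (ler_expRN d0 y0) (mulr_expRN_le d0 y0).
set y := n%:R * psi t; set E := expR _; set E2 := expR _ => H.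
have AC : 0 <= 4 * (A * (2 * C)) by rewrite !mulr_ge0// ltW.
have := ler_wpM2l AC H.
by lra.
Qed.

End kernels.

Section kernel_regularity.
Context {R : realType}.
Local Notation normc := Normc.normc.

Lemma norm_sin_le_id (t : R) : 0 <= t -> `|sin t| <= t.
Proof.
move=> t0; have := @ler_norm_sub_deriv R sin cos id (fun=> 1) (-1) (t + 1)
  (fun x _ => is_derive_sin x) (fun x _ => is_derive_id x 1)
  (fun x _ => norm_cos_le1 x) 0 t.
by rewrite sin0 !subr0; apply; lra.
Qed.

Lemma norm_1Bcos_le_id (t : R) : 0 <= t -> `|1 - cos t| <= t.
Proof.
move=> t0; have := @ler_norm_sub_deriv R cos (fun x => - sin x) id (fun=> 1) (-1) (t + 1)
  (fun x _ => is_derive_cos x) (fun x _ => is_derive_id x 1) _ 0 t.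
rewrite cos0 !subr0 distrC; apply; [|lra..].
by move=> x _; rewrite normrN norm_sin_le1.
Qed.

Lemma normc_1Bexpi (t : R) : 0 <= t -> normc (1 - expi 1 t) <= 2 * t.
Proof.
move=> t0; rewrite (le_trans (normc_le_Re_Im _))// ReD ReN ImD ImN /= mul1r opprK add0r.
by have := norm_sin_le_id t0; have := norm_1Bcos_le_id t0; lra.
Qed.

(** The difference [K x - K (x + 1)] is the coefficient at [x] of a sequence whose
    transform is that of [K] times [1 - exp (- i t)].  As this factor is at most
    [2 * t], the bounds on [t * F1] and [t * F2] yield bounds on the derivatives of
    the product that are no longer singular at [0]. *)
Lemma controlled_regular (K : ell1 R) (psi psi' : R -> R) (N A d : R)
    (F1 F2 : R -> R[i]) (x : int) :
  0 <= N -> 0 < A -> 0 < d ->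
  (forall t : R, 0 < t < pi -> 0 <= psi t) ->
  (forall t : R, 0 < t < pi -> 0 <= psi' t) ->
  (forall t : R, 0 < t < pi -> is_derive t 1 psi (psi' t)) ->
  controlled psi' N (fun t => A * expR (- (d * (N * psi t))))
    (fun t => four t K) F1 F2 ->
  x != 0 ->
  `|K x - K (x + 1)| <= (A * pi + 4 * A / d + 2 * (3 * A)) / pi / x%:~R ^+ 2.
Proof.
move=> N0 A0 d0 psi0 psi'0 Dpsi KC x0.
pose u (t : R) : R[i] := 1 - expi 1 t.
pose u1 (t : R) : R[i] := (0 +i* 1)%C * expi 1 t.
have Du t : cder u t (u1 t).
  have D := cderD (cder_cst 1 t) (cderM (cder_cst (-1) t) (cder_expi 1 t)).
  have -> : u = (fun x => 1 + -1 * expi 1 x) by apply/funext => s; rewrite mulN1r.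
  by apply: cder_eq D _; rewrite /u1; ring.
have Du1 t : cder u1 t (expi 1 t).
  have D := cderM (cder_cst (0 +i* 1)%C t) (cder_expi 1 t).
  apply: cder_eq D _; rewrite mul0r add0r mulrA mulrN.
  have -> : (0 +i* 1)%C * (0 +i* 1)%C = -1 :> R[i].
    by apply: eq_complexP; rewrite ?ReM ?ImM /=; ring.
  by rewrite opprK mul1r.
have nu t : 0 < t < pi -> normc (u t) <= 2 * t.
  by move=> /andP[t0 _]; apply: normc_1Bexpi; exact: ltW.
have nu1 t : normc (u1 t) = 1.
  by rewrite Normc.normcM normc_expi mulr1 /= expr0n add0r expr1n sqrtr1.
pose w t := A * expR (- (d * (N * psi t))).
have wA t : 0 < t < pi -> w t <= A.
  move=> t0; rewrite /w -[leRHS]mulr1 (ler_wpM2l (ltW A0))// -[leRHS]expR0 ler_expR.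
  by rewrite oppr_le0 !mulr_ge0 ?psi0// ltW.
have tF (t : R) (z : R[i]) : 0 < t < pi -> normc (t%:C%C * z) = t * normc z.
  by move=> /andP[t0 _]; rewrite Normc.normcM normc_real ger0_norm// ltW.
pose L : ell1 R := K - ell1_shift 1 K.
have fourL t : four t L = four t K * u t.
  by rewrite /L rmorphB /= four_shift -[X in X - _]mulr1 -mulrBr /u /expi.
have -> : K x - K (x + 1) = L x by [].
clearbody L u u1.
(* A primitive of the bound [A + 4 * N * psi' * w] on the second derivative; its
   oscillation does not depend on [N]. *)
pose B (t : R) : R := A * t - 4 * A / d * expR (- (d * (N * psi t))).
rewrite -[leRHS]mulrA -invfM.
apply: (@coef_bound R L (fun t => F1 t * u t + four t K * u1 t)
  (fun t => F2 t * u t + F1 t * u1 t + (F1 t * u1 t + four t K * expi 1 t))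
  B (fun t => A + 4 * (N * psi' t * w t)) (3 * A) (A * pi + 4 * A / d) x x0).
- move=> t t0; have [D1 D2 _] := KC t t0.
  under eq_fun do rewrite fourL.
  exact: cderM.
- move=> t t0; have [D1 D2 _] := KC t t0.
  by apply: cderD; exact: cderM.
- move=> t t0; have [_ _ [B0 B1 _ _]] := KC t t0.
  rewrite (le_trans (normcD _ _))// !Normc.normcM nu1 mulr1.
  rewrite tF// in B1; have := ler_wpM2l (normc_ge0 (F1 t)) (nu t t0).
  by have := wA t t0; rewrite /w; lra.
- move=> t t0; have Dp := Dpsi t t0.
  have De := @is_derive1_comp R expR (fun s => - (d * N) * psi s) t _ _ (is_derive_expR _)
     (is_derive_scal (- (d * N)) Dp).
  have D := is_deriveB (is_derive_lin A t) (is_derive_scal (4 * A / d) De).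
  have -> : B = (fun t => A * t) - (fun t => 4 * A / d * (expR \o (fun t => - (d * N) * psi t)) t).
    by apply/funext => s; rewrite /B /= !fctE mulNr mulrA.
  have d1 : d != 0 by rewrite gt_eqF.
  apply: is_derive_eq D _; rewrite /w.
  have -> : - (d * N) * psi t = - (d * (N * psi t)) by ring.
  by field.
- move=> t t0; have [_ _ [B0 B1 B2 B3]] := KC t t0.
  rewrite (le_trans (normcD4 _ _ _ _))// !Normc.normcM nu1 normc_expi !mulr1.
  rewrite tF// in B3; have := ler_wpM2l (normc_ge0 (F2 t)) (nu t t0).
  by have := wA t t0; rewrite /w; lra.
- move=> s t s0 st tpi.
  have spi : 0 < s < pi by rewrite s0 (le_lt_trans st).
  have tpi' : 0 < t < pi by rewrite tpi (lt_le_trans s0).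
  have k0 : 0 <= 4 * A / d by rewrite !mulr_ge0 ?invr_ge0// ltW.
  have es : expR (- (d * (N * psi s))) <= 1.
    by rewrite -expR0 ler_expR oppr_le0 !mulr_ge0 ?psi0// ltW.
  have et := expR_ge0 (- (d * (N * psi t))).
  have := ler_wpM2l k0 es; have := mulr_ge0 k0 et; rewrite /B.
  have : A * (t - s) <= A * pi by rewrite ler_wpM2l; lra.
  by lra.
Qed.

End kernel_regularity.

Section spectral_hypothesis.
Context {R : realType}.
Local Notation normc := Normc.normc.

Lemma deriv_within_is_derive (D : set R) (f : R -> R) (x l : R) :
  nbhs x D -> deriv_within D f x l -> is_derive x 1 f l.
Proof.
move=> Dx fl.
have H : h^-1 *: (f (h *: 1 + x) - f x) @[h --> 0^'] --> l.
  apply/cvgrPdist_lt => e e0.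
  move/cvgrPdist_lt : fl => /(_ e e0) fle.
  have /nbhs_ballP[r /= r0 rP] : \forall y \near x, y != x ->
      `|l - (f y - f x) / (y - x)| < e.
    by apply: filterS2 Dx fle => y Dy H yx; exact: H.
  exists r => //= h /=; rewrite sub0r normrN => hr h0.
  have := rP (h *: 1 + x); rewrite /ball /= scaler1 opprD addrCA subrr addr0 normrN.
  move=> /(_ hr); rewrite -subr_eq0 addrK => /(_ h0).
  by rewrite mulrC.
split; first by apply/cvg_ex; exists l.
by apply/cvg_lim.
Qed.

Lemma nbhs_punctured (t : R) : 0 < t < pi -> nbhs t (@punctured R) /\ punctured t.
Proof.
move=> /andP[t0 tpi]; have nD : nbhs t (@punctured R).
  have : `]0, pi[%classic `<=` @punctured R.
    move=> s; rewrite /= in_itv /= => /andP[s0 spi]; split.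
      by rewrite /= in_itv /=; apply/andP; split; lra.
    by move=> /= s00; move: s0; rewrite s00 ltxx.
  by move/filterS; apply; apply: near_in_itvoo; rewrite in_itv /= t0.
by split => //; exact: nbhs_singleton nD.
Qed.

Lemma hypH_is_derive (F F1 : R -> R[i]) t :
  cC1_on punctured F F1 -> 0 < t < pi -> cder F t (F1 t).
Proof.
move=> [[DR _] [DI _]] t0; have [nD Dt] := nbhs_punctured t0.
split; apply: deriv_within_is_derive nD _; [exact: DR|exact: DI].
Qed.

Lemma prob_absum (mu : int -> R) : is_prob mu -> absum mu.
Proof.
move=> [mu0 mu1]; apply/absumP.
rewrite (eq_integral (fun n : int => (mu n)%:E)) ?mu1 ?ltry// => n _.
by rewrite ger0_norm.
Qed.

Lemma prob_sum (mu : int -> R) : is_prob mu -> \int[counting]_n mu n = 1.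
Proof. by move=> [_ mu1]; rewrite /Rintegral mu1. Qed.

Lemma four0_prob (mu : ell1 R) : is_prob mu -> four 0 mu = 1.
Proof.
move=> pmu; apply: eq_complexP; last exact: Im_four0.
rewrite /four Re_fourier -[RHS](prob_sum pmu); apply: eq_sumZ => n.
by rewrite mulr0 cos0 mulr1.
Qed.

(** The transforms of the kernels are [n ^ m * h ^ n * (1 - h) ^ m]; besides the
    hypothesis on [h], this calls for a bound on [1 - h], obtained by comparing the
    increments of [h] with those of [psi]: [|h'| <= C * psi'], [h 0 = 1]. *)
Lemma kernel_regular (mu : ell1 R) (m : nat) : is_prob mu -> hypH mu ->
  exists2 D : R, 0 < D & forall (n : nat) (x : int), (0 < n)%N -> x != 0 ->
    `|(n%:R ^+ m *: (mu ^+ n * (1 - mu) ^+ m)) x -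
      (n%:R ^+ m *: (mu ^+ n * (1 - mu) ^+ m)) (x + 1)| <= D / x%:~R ^+ 2.
Proof.
move=> pmu [F1 [F2 [psi [psi' [c [C [[DF DF1] [_ cpsi psi00 [Dpsi _]] [c0 C0] HB]]]]]]].
pose h t := four t mu.
have t0_t (t : R) : 0 < t < pi -> t \in `]0, pi].
  by move=> /andP[? ?]; rewrite in_itv /=; apply/andP; split; lra.
have Dh (t : R) : 0 < t < pi -> cder h t (F1 t) /\ cder F1 t (F2 t).
  by move=> t0; split; exact: hypH_is_derive t0.
have Dp (t : R) : 0 < t < pi -> is_derive t 1 psi (psi' t).
  move=> t0; have [nD Dt] := nbhs_punctured t0.
  exact: deriv_within_is_derive nD (Dpsi t Dt).
have hB (t : R) : 0 < t < pi ->
    [/\ normc (h t) <= 1 - c * psi t, normc (t%:C%C * F1 t) <= C * psi t,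
      normc (F1 t) <= C * psi' t & normc (t%:C%C * F2 t) <= C * psi' t].
  by move=> t0; exact: HB (t0_t _ t0).
have psi0 := psi_ge0 C0 hB; have psi'0 := psi'_ge0 C0 hB.
(* Comparison with [psi] for the real and the imaginary part separately. *)
have part (f f' : R -> R) : continuous f ->
    (forall t : R, 0 < t < pi -> is_derive t 1 f (f' t)) ->
    (forall t : R, 0 < t < pi -> `|f' t| <= C * psi' t) ->
    forall t : R, 0 < t < pi -> `|f t - f 0| <= C * psi t.
  move=> cf Df fB t /andP[t0 tpi].
  have cmp := ler_norm_sub_deriv (g := fun t => C * psi t) Df
    (fun x x0 => is_derive_scal C (Dp x x0)) fB.
  apply: (ler_norm_sub_endpoints t0 (cf 0) (cf t)) => s u s0 su ut.
  have upi : u < pi by exact: lt_trans tpi.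
  apply: le_trans (cmp s u s0 su upi) _.
  have := cmp u t (lt_le_trans s0 su) (ltW ut) tpi.
  have := psi0 s; rewrite s0 (le_lt_trans su upi) => /(_ isT) ps.
  have := mulr_ge0 (ltW C0) ps.
  by move=> ? /(le_trans (normr_ge0 _)); lra.
have hB1 (t : R) : 0 < t < pi -> normc (1 - h t) <= 2 * C * psi t.
  move=> t0; rewrite -(four0_prob pmu) (le_trans (normc_le_Re_Im _))//.
  rewrite ReD ReN ImD ImN distrC [X in _ + X]distrC.
  have := part _ _ (@continuous_Re_four R mu) (fun t t0 => (Dh t t0).1.1) _ t t0.
  have := part _ _ (@continuous_Im_four R mu) (fun t t0 => (Dh t t0).1.2) _ t t0.
  have F1R u : 0 < u < pi -> `|complex.Re (F1 u)| <= C * psi' u.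
    by move=> u0; have [_ _ B _] := hB u u0; exact: le_trans (norm_Re_le _) B.
  have F1I u : 0 < u < pi -> `|complex.Im (F1 u)| <= C * psi' u.
    by move=> u0; have [_ _ B _] := hB u u0; exact: le_trans (norm_Im_le _) B.
  by move=> /(_ F1I) ? /(_ F1R) ?; lra.
have [A [d [A0 d0 AdP]]] := controlled_kernel c0 C0 Dh hB hB1 m.
exists ((A * pi + 4 * A / d + 2 * (3 * A)) / pi).
  have pi0 := pi_gt0 R.
  by rewrite divr_gt0// !addr_gt0// ?mulr_gt0// ?mulr_gt0// invr_gt0.
move=> n x n0 x0; have [G1 [G2 GC]] := AdP n n0.
apply: (controlled_regular (ler0n R n) A0 d0 psi0 psi'0 Dp _ x0).
rewrite [X in controlled _ _ _ X](_ : _ =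
  (fun t => n%:R ^+ m * (h t ^+ n * (1 - h t) ^+ m))); first exact: GC.
apply/funext => t; rewrite fourZ rmorphM !rmorphXn rmorphB rmorph1 /=.
by rewrite -[in RHS](rmorph_nat (real_complex R)).
Qed.

End spectral_hypothesis.

(** * Calderon-Zygmund decomposition on the integers *)

Section calderon_zygmund.
Context {R : realType}.
Implicit Types (f g b : ell1 R) (k c : int) (P : pred int) (lam : R).

Definition total f : R := \int[counting]_n f n.

Lemma totalD f g : total (f + g) = total f + total g.
Proof. by apply: sumZD; exact: ell1_absum. Qed.

Lemma totalZ (r : R) f : total (r *: f) = r * total f.
Proof. by apply: sumZZ; exact: ell1_absum. Qed.

Lemma totalB f g : total (f - g) = total f - total g.
Proof. by apply: sumZB; exact: ell1_absum. Qed.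

Lemma norm_total_le f : `|total f| <= norm1 f.
Proof. exact: ler_norm_sumZ. Qed.

Definition dirac1 k : ell1 R := ell1_shift (- k) 1.

Lemma dirac1E k n : dirac1 k n = (n == k)%:R.
Proof. by rewrite ell1_shiftE ell11 delta0E subr_eq0. Qed.

Lemma total_dirac1 k : total (dirac1 k) = 1.
Proof.
rewrite /total (sumZ_single (a := k)); first by rewrite dirac1E eqxx.
by move=> n /negbTE nk; rewrite dirac1E nk.
Qed.

Definition itvZ c (l : nat) : pred int := fun k => (c <= k) && (k < c + l%:Z).

Definition ind c (l : nat) : ell1 R := \sum_(i < l) dirac1 (c + i%:Z).

Lemma indE c l k : ind c l k = (itvZ c l k)%:R.
Proof.
rewrite /ind; elim: l => [|l IHl].
  by rewrite big_ord0 /itvZ addr0; case: leP => //= ?; case: ltP => //; lia.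
rewrite big_ord_recr ell1D IHl dirac1E -natrD; congr (_%:R).
by rewrite /itvZ /=; case: eqP => [->|]; lia.
Qed.

Lemma total_ind c l : total (ind c l) = l%:R.
Proof.
rewrite /ind; elim: l => [|l IHl].
  by rewrite big_ord0 /total; exact: sumZ0.
by rewrite big_ord_recr totalD IHl total_dirac1 natr1.
Qed.

Lemma ge0_norm1 f : (forall k, 0 <= f k) -> norm1 f = total f.
Proof. by move=> f0; apply: eq_sumZ => n; rewrite ger0_norm. Qed.

Lemma norm1_ind c l : norm1 (ind c l) = l%:R.
Proof. by rewrite ge0_norm1 ?total_ind// => k; rewrite indE ler0n. Qed.

Lemma absum_restr P f : absum (fun k => if P k then f k else 0).
Proof.
apply: (@le_absum _ _ (fun k => `|f k|)); last exact/absum_norm.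
by move=> k; case: ifP => //; rewrite normr0.
Qed.

Definition restr P f : ell1 R := mk_ell1 (absum_restr P f).

Lemma restrE P f k : restr P f k = if P k then f k else 0. Proof. by []. Qed.

Definition supported P f := forall k, ~~ P k -> f k = 0.

Lemma supported_restr P f : supported P (restr P f).
Proof. by move=> k /negbTE Pk; rewrite restrE Pk. Qed.

Lemma norm1D_disjoint P Q f g : supported P f -> supported Q g ->
  (forall k, P k -> ~~ Q k) -> norm1 (f + g) = norm1 f + norm1 g.
Proof.
move=> sf sg PQ; rewrite /norm1 -sumZD; [|exact: absum_norm..].
apply: eq_sumZ => k; rewrite ell1D; have [Pk|Pk] := boolP (P k).
  by rewrite (sg k (PQ k Pk)) normr0 !addr0.
by rewrite (sf k Pk) normr0 !add0r.
Qed.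

(** Bad parts are listed with the left end and the length of an interval carrying
    them.  Overlaps are irrelevant to the estimates, which depend on the total
    length only, and sums of norms and of lengths add up under concatenation. *)
Definition CZ_dec lam P f := exists (g : ell1 R) (s : seq (ell1 R * int * nat)),
  [/\ f = g + \sum_(p <- s) p.1.1,
      supported P g /\ (forall k, `|g k| <= 2 * lam),
      forall p, p \in s -> [/\ (0 < p.2)%N, supported (itvZ p.1.2 p.2) p.1.1 &
                               total p.1.1 = 0],
      \sum_(p <- s) norm1 p.1.1 <= 2 * norm1 f &
      lam * \sum_(p <- s) p.2%:R <= norm1 f].

Lemma CZ_dec_small lam P f : supported P f -> (forall k, `|f k| <= 2 * lam) ->
  CZ_dec lam P f.
Proof.
move=> sf fl; exists f, [::]; rewrite !big_nil addr0 mulr0; split => //.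
- by rewrite mulr_ge0// norm1_ge0.
- exact: norm1_ge0.
Qed.

Lemma CZ_dec_union lam P Q f g : supported P f -> supported Q g ->
  (forall k, P k -> ~~ Q k) -> CZ_dec lam P f -> CZ_dec lam Q g ->
  CZ_dec lam (fun k => P k || Q k) (f + g).
Proof.
move=> sf sg PQ [g1 [s1 [E1 [S1 B1] A1 N1 L1]]] [g2 [s2 [E2 [S2 B2] A2 N2 L2]]].
exists (g1 + g2), (s1 ++ s2).
rewrite !big_cat (norm1D_disjoint sf sg PQ); split.
- by rewrite {1}E1 {1}E2 addrACA.
- split=> k; first by rewrite negb_or => /andP[/S1 E /S2 E']; rewrite ell1D E E' addr0.
  rewrite ell1D; have [Pk|Pk] := boolP (P k).
    by rewrite (S2 k (PQ k Pk)) addr0.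
  by rewrite (S1 k Pk) add0r.
- by move=> p; rewrite mem_cat => /orP[/A1|/A2].
- by rewrite mulrDr lerD.
- by rewrite mulrDr lerD.
Qed.

(** An interval on which the mean exceeds [lam], but by a factor at most two, is
    a bad interval: subtract the mean. *)
Lemma CZ_dec_atom lam c l f : 0 < lam -> (0 < l)%N ->
  supported (itvZ c l) f -> lam * l%:R <= norm1 f -> norm1 f <= 2 * lam * l%:R ->
  CZ_dec lam (itvZ c l) f.
Proof.
move=> lam0 l0 sf fl1 fl2; have lR : 0 < (l%:R : R) by rewrite ltr0n.
pose g := (total f / l%:R) *: ind c l.
have ng : norm1 g = `|total f|.
  by rewrite norm1Z norm1_ind normrM normfV (gtr0_norm lR) divfK// gt_eqF.
exists g, [:: (f - g, c, l)]; rewrite !big_seq1; split.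
- by rewrite addrC subrK.
- split=> k; first by move=> /negbTE kI; rewrite ell1Z indE kI mulr0.
  rewrite ell1Z indE normrM normrM normfV (gtr0_norm lR) (@le_trans _ _ (`|total f| / l%:R))//.
    have t0 : 0 <= `|total f| / l%:R by rewrite divr_ge0// ltW.
    by rewrite (ler_piMr t0)//; case: (itvZ c l k); rewrite ?normr1 ?normr0.
  by rewrite ler_pdivrMr// (le_trans (norm_total_le f)).
- move=> p; rewrite inE => /eqP -> /=; split=> //.
    by move=> k kI; rewrite ell1B sf// ell1Z indE (negbTE kI) mulr0 subr0.
  by rewrite totalB totalZ total_ind divfK ?subrr// gt_eqF.
- rewrite (le_trans (norm1B _ _))// ng.
  by have := norm_total_le f; lra.
- exact: fl1.
Qed.

(** Bisect until the mean of [|f|] exceeds [lam]: the mean over the parent interval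
    being at most [lam], it is then at most [2 * lam].  At length one, a mean at
    most [lam] is a value at most [lam]. *)
Lemma CZ_dec_dyadic lam (j : nat) : 0 < lam -> forall c f,
  supported (itvZ c (2 ^ j)) f -> norm1 f <= lam * (2 ^ j)%:R ->
  CZ_dec lam (itvZ c (2 ^ j)) f.
Proof.
move=> lam0; elim: j => [|j IHj] c f sf fl.
  apply: CZ_dec_small => // k; rewrite (le_trans (le_norm1 f k))// (le_trans fl)//.
  by rewrite expn0 mulr1; lra.
have half d h : supported (itvZ d (2 ^ j)) h -> norm1 h <= norm1 f ->
    CZ_dec lam (itvZ d (2 ^ j)) h.
  move=> sh hf; have [hl|/ltW hl] := leP (norm1 h) (lam * (2 ^ j)%:R).
    exact: IHj.
  apply: CZ_dec_atom => //; first by rewrite expn_gt0.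
  rewrite (le_trans hf)// (le_trans fl)// expnS natrM; lra.
pose d := c + (2 ^ j)%:Z.
have disj k : itvZ c (2 ^ j) k -> ~~ itvZ d (2 ^ j) k by rewrite /itvZ /d; lia.
have f12 : f = restr (itvZ c (2 ^ j)) f + restr (itvZ d (2 ^ j)) f.
  apply: ell1_ext => k; rewrite ell1D !restrE.
  have := disj k; case: ifP => [_ /(_ isT)/negbTE ->|kc _]; first by rewrite addr0.
  case: ifP => [_|kd]; first by rewrite add0r.
  rewrite addr0; apply: sf; move: kc kd; rewrite /itvZ /d expnS; lia.
have N := norm1D_disjoint (@supported_restr _ f) (@supported_restr _ f) disj.
have -> : itvZ c (2 ^ j.+1) = (fun k => itvZ c (2 ^ j) k || itvZ d (2 ^ j) k).
  by apply/funext => k; rewrite /itvZ /d expnS; lia.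
have n1 := norm1_ge0 (restr (itvZ c (2 ^ j)) f).
have n2 := norm1_ge0 (restr (itvZ d (2 ^ j)) f).
rewrite -f12 in N; rewrite f12; apply: CZ_dec_union => //.
- exact: supported_restr.
- exact: supported_restr.
- by apply: half; [exact: supported_restr|lra].
- by apply: half; [exact: supported_restr|lra].
Qed.

Lemma finite_set_int_bounded (S : set int) : finite_set S ->
  exists M : nat, forall k, S k -> (`|k| <= M)%N.
Proof.
move=> fS; exists (\max_(k <- finmap.enum_fset (fset_set S)) `|k|%N) => k Sk.
by apply: (leq_bigmax_seq (F := fun k : int => `|k|%N)) => //; rewrite in_fset_set// inE.
Qed.

Lemma counting_indic (S : set int) :
  counting S = (\int[counting]_n (\1_S n)%:E)%E :> \bar R.
Proof. by rewrite integral_indic// setIT. Qed.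

(** Markov's inequality. *)
Lemma finite_large f lam : 0 < lam -> finite_set [set k | lam <= `|f k|].
Proof.
move=> lam0; set S := [set k | _].
have : (counting S < +oo :> \bar R)%E.
  rewrite counting_indic; apply: (@le_lt_trans _ _ (\int[counting]_n (lam^-1 * `|f n|)%:E)%E).
    apply: ge0_le_integral => // n _.
    rewrite lee_fin indicE; case: (boolP (n \in S)) => [|_]; last first.
      by rewrite mulr_ge0 // invr_ge0 ltW.
    by rewrite inE /S /= ler_pdivlMl// mulr1.
  by rewrite EFin_sumZ ?ltry//; exact/absumZ/absum_norm.
by rewrite /counting; case: asboolP.
Qed.

(** Only finitely many values exceed [lam].  They lie in two adjacent dyadic
    intervals, chosen so long that the mean over each is at most [lam]; outside
    these intervals [f] is already bounded. *)
Lemma CZ_decomposition lam f : 0 < lam -> CZ_dec lam predT f.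
Proof.
move=> lam0; have lam2 : lam <= 2 * lam by lra.
have [M SM] := finite_set_int_bounded (finite_large f lam0).
pose j := (M + Num.bound (norm1 f / lam))%N.
have Mj : (M < 2 ^ j)%N by rewrite (leq_ltn_trans _ (ltn_expl _ (ltnSn 1)))// leq_addr.
have fj : norm1 f <= lam * (2 ^ j)%:R.
  rewrite mulrC -ler_pdivrMr// (le_trans (ltW (archi_boundP _)))//.
    by rewrite divr_ge0 ?norm1_ge0// ltW.
  by rewrite ler_nat ltnW// (leq_ltn_trans _ (ltn_expl _ (ltnSn 1)))// leq_addl.
pose I1 := itvZ (- (2 ^ j)%:Z) (2 ^ j); pose I2 := itvZ 0 (2 ^ j).
pose O := fun k => ~~ (I1 k || I2 k).
have d12 k : I1 k -> ~~ I2 k by rewrite /I1 /I2 /itvZ; lia.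
have dO k : I1 k || I2 k -> ~~ O k by rewrite /O negbK.
have s12 : supported (fun k => I1 k || I2 k) (restr I1 f + restr I2 f).
  by move=> k; rewrite negb_or => /andP[/negbTE k1 /negbTE k2]; rewrite ell1D !restrE k1 k2 addr0.
have E : f = restr I1 f + restr I2 f + restr O f.
  apply: ell1_ext => k; rewrite !ell1D !restrE /O.
  have := d12 k; case: (I1 k) => /= [/(_ isT)/negbTE ->|_]; first by rewrite !addr0.
  by case: (I2 k); rewrite /= ?addr0 ?add0r.
have le_restr P : norm1 (restr P f) <= norm1 f.
  apply: ler_sumZ => [||k].
  - exact: absum_norm (ell1_absum (restr P f)).
  - exact: absum_norm.
  - by rewrite restrE; case: ifP; rewrite ?normr0.
have D : CZ_dec lam (fun k => (I1 k || I2 k) || O k) f.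
  rewrite [in X in CZ_dec _ _ X]E; apply: CZ_dec_union => //.
  - exact: supported_restr.
  - apply: CZ_dec_union => //; try exact: supported_restr.
      by apply: CZ_dec_dyadic => //; [exact: supported_restr|exact: le_trans fj].
    by apply: CZ_dec_dyadic => //; [exact: supported_restr|exact: le_trans fj].
  - apply: CZ_dec_small; first exact: supported_restr.
    move=> k; rewrite restrE; case: ifP => [Ok|_]; last first.
      by rewrite normr0 (le_trans (ltW lam0)).
    have [fk|fk] := leP lam `|f k|; last exact: le_trans (ltW fk) lam2.
    have := SM k fk; move: Ok; rewrite /O /I1 /I2 /itvZ; lia.
have [g [s [H1 [_ H3] H4 H5 H6]]] := D.
by exists g, s; split => //; split.
Qed.

End calderon_zygmund.

(** * Weak type (1,1) of maximal operators with regular kernels *)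

Section weak_type.
Context {R : realType}.
Implicit Types (f g b K : ell1 R) (k c x : int) (lam : R).

Lemma convol_bound K g k M : (forall n, `|g n| <= M) -> `|(K * g) k| <= norm1 K * M.
Proof.
move=> gM; have sKg := absum_convol_term k (ell1_absum K) (ell1_absum g).
rewrite ell1M (le_trans (ler_norm_sumZ sKg))//.
rewrite /norm1 mulrC -sumZZ; last exact: absum_norm.
apply: ler_sumZ; [exact: absum_norm|exact/absumZ/absum_norm|move=> n].
by rewrite normrM mulrC ler_wpM2r.
Qed.

(** At most [l] unit steps lead from [x - i] to [x], all at distance at least
    [|x| / 2] from the origin. *)
Lemma telescope_regular K D x (l : nat) : 0 <= D ->
  (forall y, y != 0 -> `|K y - K (y + 1)| <= D / y%:~R ^+ 2) ->
  (2 * l%:Z < `|x|) -> forall i : nat, (i <= l)%N ->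
  `|K (x - i%:Z) - K x| <= i%:R * (4 * D / x%:~R ^+ 2).
Proof.
move=> D0 KD lx; elim=> [|i IHi] il.
  by rewrite subr0 subrr normr0 mul0r.
pose y := x - i.+1%:Z.
have y0 : y != 0 by rewrite /y; lia.
have x0 : x != 0 by lia.
have X0 : 0 < x%:~R ^+ 2 :> R by rewrite exprn_even_gt0//= intr_eq0.
have Y0 : 0 < y%:~R ^+ 2 :> R by rewrite exprn_even_gt0//= intr_eq0.
have yx : x%:~R ^+ 2 <= 4 * y%:~R ^+ 2 :> R.
  rewrite -!rmorphXn -(intrM R 4) ler_int /y.
  by nia.
have -> : K y - K x = (K y - K (y + 1)) + (K (x - i%:Z) - K x).
  have -> : y + 1 = x - i%:Z by rewrite /y; lia.
  by ring.
rewrite (le_trans (ler_normD _ _))// -natr1 mulrDl mul1r addrC.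
apply: lerD; first exact/IHi/ltnW.
rewrite (le_trans (KD y y0))// ler_pdivrMr// mulrAC ler_pdivlMr//.
by have := ler_wpM2l D0 yx; lra.
Qed.

(** As [b] has mean zero, the constant [K (k - c)] can be subtracted from the
    kernel. *)
Lemma convol_atom K D b c (l : nat) k : 0 <= D ->
  (forall y, y != 0 -> `|K y - K (y + 1)| <= D / y%:~R ^+ 2) ->
  supported (itvZ c l) b -> total b = 0 -> 2 * l%:Z < `|k - c| ->
  `|(K * b) k| <= 4 * D * norm1 b * (l%:R / (k - c)%:~R ^+ 2).
Proof.
move=> D0 KD sb b0 lk; rewrite mulrC ell1M.
have sbK := absum_convol_term k (ell1_absum b) (ell1_absum K).
have sbc : absum (fun j => K (k - c) * b j) by exact: absumZ.
have -> : convol b K k = \int[counting]_j (b j * K (k - j) - K (k - c) * b j).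
  by rewrite sumZB// sumZZ// -/(total b) b0 mulr0 subr0.
rewrite (le_trans (ler_norm_sumZ (absumB sbK sbc)))//.
have -> : 4 * D * norm1 b * (l%:R / (k - c)%:~R ^+ 2) =
    \int[counting]_j ((l%:R * (4 * D / (k - c)%:~R ^+ 2)) * `|b j|).
  by rewrite sumZZ; [rewrite -/(norm1 b); ring|exact: absum_norm].
apply: ler_sumZ => [||j].
- exact/absum_norm/absumB.
- exact/absumZ/absum_norm.
- have [jI|jI] := boolP (itvZ c l j); last first.
    by rewrite sb// mul0r mulr0 subr0 !normr0 mulr0.
  rewrite mulrC -mulrBl normrM ler_wpM2r//.
  have [i il ->] : exists2 i : nat, (i <= l)%N & j = c + i%:Z.
    by move: jI; rewrite /itvZ => jI; exists `|j - c|%N; lia.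
  rewrite opprD addrA (le_trans (telescope_regular D0 KD lk il))//.
  by rewrite ler_wpM2r ?ler_nat// divr_ge0 ?sqr_ge0// mulr_ge0.
Qed.

(** The contribution of an atom carried by an interval of length [l], as a function
    of the distance to its left end: near the interval it is not estimated, and
    [near_ind] only counts the points; beyond, it decays like [far_tail]. *)
Definition near_ind (l : nat) x : R := (`|x| <= 2 * l%:Z)%R%:R.
Definition far_tail (l : nat) x : R :=
  if 2 * l%:Z < `|x| then l%:R / x%:~R ^+ 2 else 0.

Lemma near_ind_ge0 l x : 0 <= near_ind l x. Proof. exact: ler0n. Qed.

Lemma far_tail_ge0 l x : 0 <= far_tail l x.
Proof. by rewrite /far_tail; case: ifP => // _; rewrite divr_ge0// sqr_ge0. Qed.

Lemma sumZ_near_ind l : (0 < l)%N ->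
  (\int[counting]_x (near_ind l x)%:E <= (5 * l%:R)%:E)%E.
Proof.
move=> l0; rewrite (eq_integral (fun x : int => (ind (- (2 * l)%N%:Z) (4 * l).+1 x)%:E)).
  rewrite EFin_sumZ// lee_fin -/(total _) total_ind -natr1 natrM.
  have : 1 <= (l%:R : R) by rewrite ler1n.
  by lra.
by move=> x _; rewrite indE /near_ind /itvZ; congr (_%:R%:E); lia.
Qed.

(** Monotone convergence, in the form that lets an infinite sum be bounded through
    finitely supported functions. *)
Lemma sumZ_le_truncations (F : int -> R) (B : R) : (forall x, 0 <= F x) ->
  (forall N : nat, exists2 G : ell1 R, total G <= B &
     forall x, 0 <= G x /\ (`|x| <= N%:Z -> F x <= G x)) ->
  (\int[counting]_x (F x)%:E <= B%:E)%E.
Proof.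
move=> F0 FG.
pose T (N : nat) (x : int) : \bar R := (if `|x| <= N%:Z then F x else 0)%:E.
have limT x : limn (T^~ x) = (F x)%:E.
  apply/cvg_lim => //; apply: cvg_near_cst; exists `|x|%N => // N /= xN.
  by rewrite /T ifT//; lia.
rewrite (eq_integral (fun x => limn (T^~ x))); last by move=> x _; rewrite limT.
rewrite monotone_convergence//.
- apply: lime_le.
    apply: ereal_nondecreasing_is_cvgn => N N' NN'.
    apply: ge0_le_integral => // x _; rewrite /T ?lee_fin.
      by case: ifP.
    by case: ifPn => // xN; [rewrite ifT//; lia|case: ifP].
  apply: nearW => N; have [G GB GF] := FG N.
  rewrite (le_trans _ (_ : (total G)%:E <= B%:E)%E) ?lee_fin// /total -EFin_sumZ//.
  apply: ge0_le_integral => //.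
    by move=> x _; rewrite /T lee_fin; case: ifP.
  by move=> x _; rewrite /T lee_fin; case: ifPn => [/(GF x).2//|_]; exact: (GF x).1.
- by move=> N x _; rewrite /T lee_fin; case: ifP.
- move=> x _ N N' NN'; rewrite /T lee_fin.
  by case: ifPn => // xN; [rewrite ifT//; lia|case: ifP].
Qed.

Lemma sqr_intr_norm x : (`|x|%:~R : R) ^+ 2 = x%:~R ^+ 2.
Proof. by rewrite intr_norm real_normK ?num_real. Qed.

Lemma sumZ_far_tail l : (0 < l)%N -> (\int[counting]_x (far_tail l x)%:E <= 1)%E.
Proof.
move=> l0; apply: sumZ_le_truncations => [|N]; first exact: far_tail_ge0.
have lR : 0 < (l%:R : R) by rewrite ltr0n.
pose r (i : nat) : R := l%:R / (2 * l + i.+1)%:R ^+ 2.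
pose G (M : nat) : ell1 R := \sum_(i < M)
  (r i *: dirac1 (2 * l + i.+1)%N%:Z + r i *: dirac1 (- (2 * l + i.+1)%N%:Z)).
have GE M x : G M x =
    if (2 * l%:Z < `|x|) && (`|x| <= (2 * l + M)%N%:Z) then l%:R / x%:~R ^+ 2 else 0.
  rewrite /G; elim: M => [|M IHM]; first by rewrite big_ord0 ifF//; lia.
  rewrite big_ord_recr !ell1D IHM !ell1Z !dirac1E /=.
  pose a := (2 * l + M.+1)%N.
  have [xa|xa] := eqVneq `|x| a%:Z.
    have -> : (2 * l%:Z < `|x|) && (`|x| <= (2 * l + M)%N%:Z) = false by lia.
    have -> : (2 * l%:Z < `|x|) && (`|x| <= (2 * l + M.+1)%N%:Z) by lia.
    have x2 : x%:~R ^+ 2 = a%:R ^+ 2 :> R.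
      by rewrite -sqr_intr_norm xa.
    rewrite x2 add0r /r -/a; have [->|xNa] := eqVneq x a%:Z.
      by rewrite (_ : (a%:Z == - a%:Z) = false) ?mulr1 ?mulr0 ?addr0//; lia.
    by rewrite (_ : x == - a%:Z) ?mulr1 ?mulr0 ?add0r//; lia.
  rewrite -/a; have -> : (x == a%:Z) = false by move/negP: xa => xa; apply/negP => /eqP xa'; lia.
  have -> : (x == - a%:Z) = false by move/negP: xa => xa; apply/negP => /eqP xa'; lia.
  rewrite !mulr0 !addr0; congr (if _ then _ else _); move: xa; rewrite /a; lia.
(* Telescoping, by [1 / (a + 1) ^ 2 <= 1 / a - 1 / (a + 1)]. *)
have GT M : total (G M) <= 1 - 2 * l%:R / (2 * l + M)%:R.
  rewrite /G; elim: M => [|M IHM].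
    rewrite big_ord0 /total sumZ0 addn0 natrM divff ?subrr//.
    by rewrite mulf_neq0// gt_eqF.
  rewrite big_ord_recr !totalD !totalZ !total_dirac1 !mulr1 /=.
  have aS : (2 * l + M.+1)%:R = (2 * l + M)%:R + 1 :> R by rewrite addnS natr1.
  apply: le_trans (lerD IHM (lexx _)) _; rewrite /r aS.
  have : 0 < ((2 * l + M)%:R : R) by rewrite ltr0n addn_gt0 muln_gt0 l0.
  move: ((2 * l + M)%:R : R) => a a0.
  have a1 : a + 1 != 0 by rewrite gt_eqF//; lra.
  have a2 : a != 0 by rewrite gt_eqF.
  rewrite -subr_ge0.
  have -> : 1 - 2 * l%:R / (a + 1)
      - (1 - 2 * l%:R / a + (l%:R / (a + 1) ^+ 2 + l%:R / (a + 1) ^+ 2))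
     = 2 * l%:R / (a * (a + 1) ^+ 2) by field; rewrite a1 a2.
  by rewrite divr_ge0 ?mulr_ge0 ?exprn_ge0//; lra.
exists (G N).
  rewrite (le_trans (GT N))// lerBlDr lerDl divr_ge0//.
move=> x; rewrite GE; split.
  by case: ifP => // _; rewrite divr_ge0// sqr_ge0.
rewrite /far_tail => xN; case: ifP => // xl; rewrite ifT//.
by apply/andP; split => //; lia.
Qed.

(** The kernels are bounded in norm, which takes care of the bounded part of [f],
    and Lipschitz away from the origin, which makes the contribution of a bad
    interval summable outside an enlargement of it. *)
Lemma weak_type_real (K : nat -> ell1 R) (A D : R) : 0 < A -> 0 <= D ->
  (forall n, (0 < n)%N -> norm1 (K n) <= A) ->
  (forall n y, (0 < n)%N -> y != 0 -> `|K n y - K n (y + 1)| <= D / y%:~R ^+ 2) ->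
  forall f lam, 0 < lam ->
  (counting [set k : int | (lam%:E <= ereal_sup
       [set `|(K n * f) k|%:E | n in [set n : nat | (1 <= n)%N]])%E]
   <= ((20 * A + 16 * D) / lam * norm1 f)%:E)%E.
Proof.
move=> A0 D0 KA KD f lam lam0; set S := [set k | _].
(* At this level the good part is at most [lam / (2 * A)], hence contributes at
   most [lam / 2] to the maximal function. *)
have la0 : 0 < lam / (4 * A) by rewrite divr_gt0// mulr_gt0.
have [g [s [fE [_ gB] sP sN sL]]] := CZ_decomposition f la0.
pose W (p : ell1 R * int * nat) k : R := near_ind p.2 (k - p.1.2)
  + 2 / lam * (4 * D * norm1 p.1.1 * far_tail p.2 (k - p.1.2)).
have W0 p k : 0 <= W p k.
  by rewrite addr_ge0 ?near_ind_ge0// !mulr_ge0 ?invr_ge0 ?norm1_ge0 ?far_tail_ge0// ltW.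
(* The weights [W p] majorize the level set: a point of [S] is near one of the
   intervals, or the tails of the atoms exceed [lam / 2] there. *)
have key k : S k -> 1 <= \sum_(p <- s) W p k.
  move=> Sk; have [/hasP[p ps near]|/hasPn far] :=
    boolP (has (fun p => `|k - p.1.2| <= 2 * p.2%:Z) s).
    rewrite (big_rem p)//= (@le_trans _ _ (W p k))//; last first.
      by rewrite lerDl sumr_ge0.
    rewrite /W /near_ind near lerDl.
    by rewrite !mulr_ge0 ?invr_ge0 ?norm1_ge0 ?far_tail_ge0// ltW.
  pose m (p : ell1 R * int * nat) := 4 * D * norm1 p.1.1 * far_tail p.2 (k - p.1.2).
  have bound n : (0 < n)%N -> `|(K n * f) k| <= lam / 2 + \sum_(p <- s) m p.
    move=> n0; rewrite fE mulrDr mulr_sumr ell1D (le_trans (ler_normD _ _))// lerD//.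
      rewrite (le_trans (convol_bound (K n) k gB))//.
      have -> : lam / 2 = A * (2 * (lam / (4 * A))) by field; lra.
      by rewrite ler_wpM2r ?KA// mulr_ge0// ltW.
    have -> : (\sum_(p <- s) K n * p.1.1) k = \sum_(p <- s) (K n * p.1.1) k.
      by elim/big_rec2: _ => [|p y1 y2 _ <-].
    rewrite (le_trans (ler_norm_sum _ _ _))// !big_seq ler_sum// => p ps.
    have [p0 sb b0] := sP p ps; have := far p ps; rewrite -ltNge => pfar.
    rewrite (le_trans (convol_atom D0 (KD n ^~ n0) sb b0 pfar))//.
    by rewrite /m /far_tail pfar.
  have : lam <= lam / 2 + \sum_(p <- s) m p.
    rewrite -lee_fin (le_trans Sk)//; apply: ub_ereal_sup => _ [n n0 <-].
    by rewrite lee_fin bound.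
  move=> H; have : 1 <= 2 / lam * \sum_(p <- s) m p.
    by rewrite -ler_pdivrMl ?divr_gt0// invf_div mulr1; lra.
  move/le_trans; apply; rewrite mulr_sumr ler_sum// => p _.
  by rewrite /W lerDr near_ind_ge0.
have shift (F : int -> R) (c : int) : (forall x, 0 <= F x) ->
    (\int[counting]_k (F ((k : int) - c))%:E = \int[counting]_k (F k)%:E)%E.
  move=> F0; apply: (ge0_sumZ_bij (s := fun k => k - c) (t := fun k => k + c)
    (f := fun k => (F k)%:E)) => k; rewrite ?addrK ?subrK// lee_fin; exact: F0.
have IW p : p \in s ->
    (\int[counting]_k (W p k)%:E <= (5 * p.2%:R + 8 * D / lam * norm1 p.1.1)%:E)%E.
  move=> ps; have [p0 _ _] := sP p ps.
  have k0 : 0 <= 2 / lam * (4 * D * norm1 p.1.1).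
    by rewrite !mulr_ge0 ?invr_ge0 ?norm1_ge0// ltW.
  under eq_integral do rewrite /W mulrA EFinD EFinM.
  rewrite ge0_integralD//; last 2 first.
  - by move=> x _; rewrite lee_fin near_ind_ge0.
  - by move=> x _; rewrite mule_ge0// lee_fin// far_tail_ge0.
  rewrite ge0_integralZl//; last by move=> x _; rewrite lee_fin far_tail_ge0.
  rewrite (shift (near_ind p.2)) ?(shift (far_tail p.2)); last 2 first.
  - exact: far_tail_ge0.
  - exact: near_ind_ge0.
  rewrite EFinD leeD ?sumZ_near_ind//.
  rewrite (_ : 8 * D / lam * norm1 p.1.1 = 2 / lam * (4 * D * norm1 p.1.1)); last by ring.
  by rewrite -[leRHS]mule1 lee_wpmul2l ?lee_fin// sumZ_far_tail.
rewrite counting_indic (@le_trans _ _ (\int[counting]_k (\sum_(p <- s) (W p k)%:E)%E)%E)//.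
  apply: ge0_le_integral => // k _.
  rewrite sumEFin lee_fin indicE; case: (boolP (k \in S)) => [|_].
    by rewrite inE => /key.
  by rewrite sumr_ge0.
rewrite ge0_integral_sum//; last by move=> p k _; rewrite lee_fin W0.
rewrite (@le_trans _ _ (\sum_(p <- s) (5 * p.2%:R + 8 * D / lam * norm1 p.1.1)%:E)%E)//.
  by rewrite !big_seq lee_sum.
rewrite sumEFin lee_fin big_split/= -!mulr_sumr.
have D1 : 0 <= 8 * D / lam by rewrite !mulr_ge0 ?invr_ge0// ltW.
have := ler_wpM2l D1 sN.
have : \sum_(p <- s) p.2%:R <= 4 * A / lam * norm1 f.
  by rewrite -ler_pdivrMl ?divr_gt0 ?mulr_gt0// invf_div.
move=> H1 H2.
have -> : (20 * A + 16 * D) / lam * norm1 f =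
  5 * (4 * A / lam * norm1 f) + 8 * D / lam * (2 * norm1 f) by ring.
by lra.
Qed.

End weak_type.

(** * Stability of the spectral hypothesis *)

Section C1_rules.
Context {R : realType}.
Implicit Types (D : set R) (f g : R -> R) (F G : R -> R[i]).

Lemma deriv_withinD D f g x (l m : R) : deriv_within D f x l ->
  deriv_within D g x m -> deriv_within D (fun y => f y + g y) x (l + m).
Proof.
move=> fl gm; rewrite /deriv_within.
under eq_fun do rewrite opprD addrACA mulrDl.
exact: cvgD.
Qed.

Lemma deriv_withinM D f g x (l m : R) : deriv_within D f x l ->
  deriv_within D g x m -> deriv_within D (fun y => f y * g y) x (l * g x + f x * m).
Proof.
move=> fl gm; rewrite /deriv_within.
have yx : y @[y --> within D x^'] --> x.
  by do 2 apply: cvg_within_filter; exact: cvg_id.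
have gx : g y @[y --> within D x^'] --> g x.
  have H : (y - x) * ((g y - g x) / (y - x)) + g x @[y --> within D x^'] --> (x - x) * m + g x.
    by apply: cvgD; [apply: cvgM gm; apply: cvgB => //; exact: cvg_cst|exact: cvg_cst].
  rewrite subrr mul0r add0r in H; apply: cvg_trans H; apply: near_eq_cvg.
  have ne : \forall y \near within D x^', y != x.
    suff : \forall y \near x, y != x -> D y -> y != x by [].
    by apply: (@filterE _ (nbhs x)).
  apply: filterS ne => y yx0; rewrite -subr_eq0 in yx0.
  by rewrite mulrCA divff// mulr1 subrK.
have H : (f y - f x) / (y - x) * g y + f x * ((g y - g x) / (y - x))
    @[y --> within D x^'] --> l * g x + f x * m.
  by apply: cvgD; apply: cvgM => //; exact: cvg_cst.
apply: cvg_trans H; apply: near_eq_cvg; apply: nearW => y.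
by rewrite mulrAC mulrA -mulrDl; congr (_ / _); ring.
Qed.

Lemma C1_onD D f g (f' g' : R -> R) : C1_on D f f' -> C1_on D g g' ->
  C1_on D (fun y => f y + g y) (fun y => f' y + g' y).
Proof.
move=> [Df cf] [Dg cg]; split=> [x Dx|x].
  by apply: deriv_withinD; [exact: Df|exact: Dg].
exact: (@continuousD _ _ (subspace D) f' g' x (cf x) (cg x)).
Qed.

Lemma C1_onM D f g (f' g' : R -> R) : C1_on D f f' -> C1_on D g g' ->
  {within D, continuous f} -> {within D, continuous g} ->
  C1_on D (fun y => f y * g y) (fun y => f' y * g y + f y * g' y).
Proof.
move=> [Df cf'] [Dg cg'] cf cg; split=> [x Dx|x].
  by apply: deriv_withinM; [exact: Df|exact: Dg].
apply: (@continuousD _ _ (subspace D) (fun y => f' y * g y) (fun y => f y * g' y)).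
  exact: (@continuousM _ (subspace D) f' g x (cf' x) (cg x)).
exact: (@continuousM _ (subspace D) f g' x (cf x) (cg' x)).
Qed.

Lemma C1_on_cst D (r : R) : C1_on D (fun=> r) (fun=> 0).
Proof.
split=> [x Dx|x]; last exact: cst_continuous.
rewrite /deriv_within; under eq_fun do rewrite subrr mul0r.
exact: cvg_cst.
Qed.

Definition ccont D F := {within D, continuous (fun x => complex.Re (F x))} /\
  {within D, continuous (fun x => complex.Im (F x))}.

Lemma cC1_on_ccont D F F1 : cC1_on D F F1 -> ccont D F1.
Proof. by move=> [[_ ?] [_ ?]]. Qed.

Lemma ccont_fourier D (a : ell1 R) : ccont D (fourier a).
Proof.
split; apply: continuous_subspaceT.
  exact: continuous_Re_four.
exact: continuous_Im_four.
Qed.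

Lemma cC1_onD D F G (F1 G1 : R -> R[i]) : cC1_on D F F1 -> cC1_on D G G1 ->
  cC1_on D (fun x => F x + G x) (fun x => F1 x + G1 x).
Proof.
move=> [FR FI] [GR GI]; split.
  under eq_fun do rewrite ReD; under [X in C1_on _ _ X]eq_fun do rewrite ReD.
  exact: C1_onD.
under eq_fun do rewrite ImD; under [X in C1_on _ _ X]eq_fun do rewrite ImD.
exact: C1_onD.
Qed.

Lemma C1_onZ D f (f' : R -> R) (r : R) : C1_on D f f' ->
  C1_on D (fun x => r * f x) (fun x => r * f' x).
Proof.
move=> [Df cf]; split=> [x Dx|x].
  have := deriv_withinM (((@C1_on_cst D r).1 x) Dx) (Df x Dx).
  by rewrite mul0r add0r.
by apply: (@continuousM _ (subspace D) (fun=> r) f' x) (cf x); exact: cst_continuous.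
Qed.

Lemma C1_onN D f (f' : R -> R) : C1_on D f f' ->
  C1_on D (fun x => - f x) (fun x => - f' x).
Proof.
by move/(C1_onZ (-1)); congr (C1_on _ _ _); apply/funext => x; rewrite mulN1r.
Qed.

Lemma cC1_onM D F G (F1 G1 : R -> R[i]) : cC1_on D F F1 -> cC1_on D G G1 ->
  ccont D F -> ccont D G ->
  cC1_on D (fun x => F x * G x) (fun x => F1 x * G x + F x * G1 x).
Proof.
move=> [FR FI] [GR GI] [cFR cFI] [cGR cGI]; split.
  have := C1_onD (C1_onM FR GR cFR cGR) (C1_onN (C1_onM FI GI cFI cGI)).
  congr (C1_on _ _ _); apply/funext => x; first by rewrite ReM.
  by rewrite ReD !ReM; ring.
have := C1_onD (C1_onM FR GI cFR cGI) (C1_onM FI GR cFI cGR).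
congr (C1_on _ _ _); apply/funext => x; first by rewrite ImM.
by rewrite ImD !ImM; ring.
Qed.

Lemma cC1_onZ D F (F1 : R -> R[i]) (r : R) : cC1_on D F F1 ->
  cC1_on D (fun x => r%:C%C * F x) (fun x => r%:C%C * F1 x).
Proof.
move=> [/(C1_onZ r) FR /(C1_onZ r) FI]; split.
  move: FR; congr (C1_on _ _ _); apply/funext => x.
    by rewrite ReM /= mul0r subr0.
  by rewrite ReM /= mul0r subr0.
move: FI; congr (C1_on _ _ _); apply/funext => x.
  by rewrite ImM /= mul0r addr0.
by rewrite ImM /= mul0r addr0.
Qed.

End C1_rules.

Section hypH_stability.
Context {R : realType}.
Local Notation normc := Normc.normc.
Implicit Types (mu nu : ell1 R).

(** With [a = c1 * u] and [b = c2 * v] in [[0, 1]], one has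
    [(1 - a) * (1 - b) <= 1 - (a + b) / 2], so [u + v] can play the role of [psi].
    In the second derivative, the cross terms [(t * h1) * k1] are bounded by
    [C1 * u * (C2 * v')], where [u <= 1 / c1]. *)
Lemma hypH_convol mu nu : hypH mu -> hypH nu -> hypH (convol mu nu).
Proof.
move=> [h1 [h2 [u [u' [c1 [C1 [[Dh Dh1] [eu cu u0 Du] [c10 C10] HB]]]]]]].
move=> [k1 [k2 [v [v' [c2 [C2 [[Dk Dk1] [ev cv v0 Dv] [c20 C20] KB]]]]]]].
pose h := fourier mu; pose k := fourier nu.
have hkE : fourier (convol mu nu) = fun t => h t * k t.
  by apply/funext => t; exact: (rmorphM (four t) mu nu).
have ch := ccont_fourier punctured mu; have ck := ccont_fourier punctured nu.
pose c := Num.min c1 c2 / 2.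
have cm1 : Num.min c1 c2 <= c1 by rewrite ge_min lexx.
have cm2 : Num.min c1 c2 <= c2 by rewrite ge_min lexx orbT.
have cm0 : 0 < Num.min c1 c2 by rewrite lt_min c10.
have C120 : 0 < C1 * C2 / c1 by rewrite !mulr_gt0 ?invr_gt0.
exists (fun t => h1 t * k t + h t * k1 t),
  (fun t => h2 t * k t + h1 t * k1 t + (h1 t * k1 t + h t * k2 t)),
  (fun t => u t + v t), (fun t => u' t + v' t), c, (C1 + C2 + 2 * (C1 * C2 / c1)).
split.
- rewrite hkE; split; first exact: cC1_onM.
  have ch1 := cC1_on_ccont Dh; have ck1 := cC1_on_ccont Dk.
  by apply: cC1_onD; exact: cC1_onM.
- split.
  + by move=> t tI; rewrite eu// ev.
  + by move=> x; exact: (@continuousD _ _ (subspace _) u v x (cu x) (cv x)).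
  + by rewrite u0 v0 addr0.
  + exact: C1_onD.
- by split; [rewrite /c; lra|lra].
move=> t tI; rewrite hkE.
have [H0 H1 H2 H3] := HB t tI; have [K0 K1 K2 K3] := KB t tI.
rewrite -/(h t) in H0; rewrite -/(k t) in K0.
have ut : 0 <= u t by rewrite -(pmulr_rge0 _ C10) (le_trans (normc_ge0 _) H1).
have vt : 0 <= v t by rewrite -(pmulr_rge0 _ C20) (le_trans (normc_ge0 _) K1).
have u't : 0 <= u' t by rewrite -(pmulr_rge0 _ C10) (le_trans (normc_ge0 _) H2).
have v't : 0 <= v' t by rewrite -(pmulr_rge0 _ C20) (le_trans (normc_ge0 _) K2).
have a1 := le_trans (normc_ge0 _) H0; have b1 := le_trans (normc_ge0 _) K0.
have a0 : 0 <= c1 * u t by rewrite mulr_ge0// ltW.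
have b0 : 0 <= c2 * v t by rewrite mulr_ge0// ltW.
have h_1 : normc (h t) <= 1 by lra.
have k_1 : normc (k t) <= 1 by lra.
have n0 := @normc_ge0 R.
have C1u := mulr_ge0 (ltW C10) ut; have C2v := mulr_ge0 (ltW C20) vt.
have C1v := mulr_ge0 (ltW C10) vt; have C2u := mulr_ge0 (ltW C20) ut.
have C1u' := mulr_ge0 (ltW C10) u't; have C2v' := mulr_ge0 (ltW C20) v't.
have C1v' := mulr_ge0 (ltW C10) v't; have C2u' := mulr_ge0 (ltW C20) u't.
have E1 := mulr_ge0 (ltW C120) ut; have E2 := mulr_ge0 (ltW C120) vt.
have E3 := mulr_ge0 (ltW C120) u't; have E4 := mulr_ge0 (ltW C120) v't.
split.
- rewrite Normc.normcM (le_trans (ler_pM (n0 _) (n0 _) H0 K0))//.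
  have cu' : c * u t <= c1 * u t / 2 by rewrite /c mulrAC ler_pM2r// ler_wpM2r.
  have cv' : c * v t <= c2 * v t / 2 by rewrite /c mulrAC ler_pM2r// ler_wpM2r.
  rewrite mulrDr; have := mulr_ge0 a0 b1; have := mulr_ge0 b0 a1.
  by lra.
- have -> : t%:C%C * (h1 t * k t + h t * k1 t) =
      (t%:C%C * h1 t) * k t + h t * (t%:C%C * k1 t) by ring.
  rewrite (le_trans (normcD _ _))// (Normc.normcM _ (k t)) (Normc.normcM (h t)).
  have := ler_pM (n0 _) (n0 _) H1 k_1; have := ler_pM (n0 _) (n0 _) h_1 K1.
  by lra.
- rewrite (le_trans (normcD _ _))// !Normc.normcM.
  have := ler_pM (n0 _) (n0 _) H2 k_1; have := ler_pM (n0 _) (n0 _) h_1 K2.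
  by lra.
- have -> : t%:C%C * (h2 t * k t + h1 t * k1 t + (h1 t * k1 t + h t * k2 t)) =
    (t%:C%C * h2 t) * k t + (t%:C%C * h1 t) * k1 t +
    ((t%:C%C * h1 t) * k1 t + h t * (t%:C%C * k2 t)) by ring.
  rewrite (le_trans (normcD4 _ _ _ _))// !(Normc.normcM _ (k t)) !(Normc.normcM _ (k1 t)).
  rewrite (Normc.normcM (h t)).
  have := ler_pM (n0 _) (n0 _) H3 k_1; have := ler_pM (n0 _) (n0 _) h_1 K3.
  have := ler_pM (n0 _) (n0 _) H1 K2.
  have : C1 * u t * (C2 * v' t) <= C1 * C2 / c1 * v' t.
    have -> : C1 * u t * (C2 * v' t) = (C1 * C2 / c1 * v' t) * (c1 * u t).
      by field; rewrite gt_eqF.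
    by rewrite ler_piMr//; lra.
  by lra.
Qed.

(** Again [u + v] works: the bounds of each measure are weakened by adding those of
    the other one. *)
Lemma hypH_conv mu nu (r : R) : 0 < r < 1 -> hypH mu -> hypH nu ->
  hypH (r *: mu + (1 - r) *: nu : ell1 R).
Proof.
move=> /andP[r0 r1].
move=> [h1 [h2 [u [u' [c1 [C1 [[Dh Dh1] [eu cu u0 Du] [c10 C10] HB]]]]]]].
move=> [k1 [k2 [v [v' [c2 [C2 [[Dk Dk1] [ev cv v0 Dv] [c20 C20] KB]]]]]]].
pose h := fourier mu; pose k := fourier nu.
have s0 : 0 < 1 - r by lra.
have hkE : fourier (r *: mu + (1 - r) *: nu : ell1 R) =
    fun t => r%:C%C * h t + (1 - r)%:C%C * k t.
  by apply/funext => t; rewrite -[LHS]/(four t _) rmorphD /= !fourZ.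
pose c := Num.min (r * c1) ((1 - r) * c2).
have cm1 : c <= r * c1 by rewrite ge_min lexx.
have cm2 : c <= (1 - r) * c2 by rewrite ge_min lexx orbT.
have cm0 : 0 < c by rewrite lt_min !mulr_gt0.
exists (fun t => r%:C%C * h1 t + (1 - r)%:C%C * k1 t),
  (fun t => r%:C%C * h2 t + (1 - r)%:C%C * k2 t),
  (fun t => u t + v t), (fun t => u' t + v' t), c, (C1 + C2).
split.
- by rewrite hkE; split; apply: cC1_onD; exact: cC1_onZ.
- split.
  + by move=> t tI; rewrite eu// ev.
  + by move=> x; exact: (@continuousD _ _ (subspace _) u v x (cu x) (cv x)).
  + by rewrite u0 v0 addr0.
  + exact: C1_onD.
- by split; lra.
move=> t tI; rewrite hkE.
have [H0 H1 H2 H3] := HB t tI; have [K0 K1 K2 K3] := KB t tI.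
rewrite -/(h t) in H0; rewrite -/(k t) in K0.
have ut : 0 <= u t by rewrite -(pmulr_rge0 _ C10) (le_trans (normc_ge0 _) H1).
have vt : 0 <= v t by rewrite -(pmulr_rge0 _ C20) (le_trans (normc_ge0 _) K1).
have u't : 0 <= u' t by rewrite -(pmulr_rge0 _ C10) (le_trans (normc_ge0 _) H2).
have v't : 0 <= v' t by rewrite -(pmulr_rge0 _ C20) (le_trans (normc_ge0 _) K2).
have C1v := mulr_ge0 (ltW C10) vt; have C2u := mulr_ge0 (ltW C20) ut.
have C1v' := mulr_ge0 (ltW C10) v't; have C2u' := mulr_ge0 (ltW C20) u't.
have n0 := @normc_ge0 R.
have mix (x y : R[i]) : normc (r%:C%C * x + (1 - r)%:C%C * y) <=
    r * normc x + (1 - r) * normc y.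
  rewrite (le_trans (normcD _ _))// !Normc.normcM !normc_real.
  by rewrite !gtr0_norm.
have mix1 (x y a b : R) : 0 <= x -> 0 <= y -> x <= a -> y <= b ->
    r * x + (1 - r) * y <= a + b.
  move=> x0 y0 xa yb; have := mulr_ge0 (ltW s0) x0; have := mulr_ge0 (ltW r0) y0.
  by lra.
have tmix (x y : R[i]) : t%:C%C * (r%:C%C * x + (1 - r)%:C%C * y) =
    r%:C%C * (t%:C%C * x) + (1 - r)%:C%C * (t%:C%C * y) by ring.
split.
- rewrite (le_trans (mix _ _))//.
  have := ler_wpM2l (ltW r0) H0; have := ler_wpM2l (ltW s0) K0.
  have := ler_wpM2r ut cm1; have := ler_wpM2r vt cm2.
  by lra.
- rewrite tmix (le_trans (mix _ _))// (le_trans (mix1 _ _ _ _ (n0 _) (n0 _) H1 K1))//.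
  by lra.
- rewrite (le_trans (mix _ _))// (le_trans (mix1 _ _ _ _ (n0 _) (n0 _) H2 K2))//.
  by lra.
- rewrite tmix (le_trans (mix _ _))// (le_trans (mix1 _ _ _ _ (n0 _) (n0 _) H3 K3))//.
  by lra.
Qed.

Definition conjc (z : R[i]) : R[i] := (complex.Re z -i* complex.Im z)%C.

Lemma normc_conj z : normc (conjc z) = normc z.
Proof. by case: z => a b /=; rewrite sqrrN. Qed.

Lemma cC1_on_conj D (F F1 : R -> R[i]) : cC1_on D F F1 ->
  cC1_on D (fun t => conjc (F t)) (fun t => conjc (F1 t)).
Proof. by move=> [FR FI]; split => //; exact: C1_onN. Qed.

Lemma absum_symm (a : int -> R) : absum a -> absum (symm a).
Proof. by apply: (@absum_bij R (fun n => - n) (fun n => - n)) => n; rewrite opprK. Qed.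

Lemma sumZ_symm (a : int -> R) : absum a ->
  \int[counting]_n symm a n = \int[counting]_n a n.
Proof. by apply: (@sumZ_bij R (fun n => - n) (fun n => - n)) => n; rewrite opprK. Qed.

Lemma fourier_symm mu t : fourier (symm mu) t = conjc (fourier mu t).
Proof.
apply: eq_complexP; rewrite /conjc ?Re_fourier ?Im_fourier /=.
  rewrite -[RHS](sumZ_symm (absum_cos mu t)); apply: eq_sumZ => n.
  by rewrite /symm rmorphN mulNr cosN.
rewrite -(sumZ_symm (absum_sin mu t)) -[RHS]mulN1r -sumZZ.
  by apply: eq_sumZ => n; rewrite /symm mulN1r rmorphN mulNr sinN mulrN opprK.
exact: absum_symm (absum_sin mu t).
Qed.

Lemma hypH_symm mu : hypH mu -> hypH (symm mu).
Proof.
move=> [h1 [h2 [u [u' [c [C [[Dh Dh1] Hu HC HB]]]]]]].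
exists (fun t => conjc (h1 t)), (fun t => conjc (h2 t)), u, u', c, C; split => //.
- have -> : fourier (symm mu) = fun t => conjc (fourier mu t).
    by apply/funext => t; exact: fourier_symm.
  by split; exact: cC1_on_conj.
- move=> t tI; have [H0 H1 H2 H3] := HB t tI.
  rewrite fourier_symm !Normc.normcM !normc_conj -!Normc.normcM; split => //.
Qed.

End hypH_stability.

(** * Ritt measures *)

Section ritt_measures.
Context {R : realType}.
Implicit Types (mu nu : ell1 R) (n m : nat) (r C : R).

Lemma is_probP (a : int -> R) : is_prob a <->
  [/\ forall k : int, 0 <= a k, absum a & \int[counting]_n a n = 1].
Proof.
split=> [pa|[a0 sa a1]]; last first.
  by split; [exact: a0|have := EFin_sumZ sa; rewrite a1].
by split; [case: pa|exact: prob_absum|exact: prob_sum].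
Qed.

Definition prob_ell1 (a : int -> R) (pa : is_prob a) : ell1 R := mk_ell1 (prob_absum pa).

Lemma norm1_prob mu : is_prob mu -> norm1 mu = 1.
Proof. by move=> pmu; rewrite ge0_norm1 ?/total ?prob_sum//; case: pmu. Qed.

Lemma is_prob_convol mu nu : is_prob mu -> is_prob nu -> is_prob (convol mu nu).
Proof.
move=> pmu pnu; apply/is_probP; split.
- by move=> k; apply: Rintegral_ge0 => j _; rewrite mulr_ge0 ?(pmu.1)// ?(pnu.1).
- exact: absum_convol.
- have := @sumZ_convol R mu nu (fun=> 1) 1 (ell1_absum mu) (ell1_absum nu).
  under eq_Rintegral do rewrite mulr1; move=> ->; last by rewrite normr1.
  under eq_Rintegral do under eq_Rintegral do rewrite mulr1.
  rewrite (prob_sum pnu); under eq_Rintegral do rewrite mulr1.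
  exact: prob_sum.
Qed.

Lemma is_prob_conv mu nu r : 0 < r < 1 -> is_prob mu -> is_prob nu ->
  is_prob (r *: mu + (1 - r) *: nu : ell1 R).
Proof.
move=> /andP[r0 r1] pmu pnu; apply/is_probP; split.
- move=> k; rewrite ell1D !ell1Z addr_ge0// mulr_ge0 ?(pmu.1) ?(pnu.1)//; lra.
- exact: ell1_absum.
- by rewrite -/(total _) totalD !totalZ /total !prob_sum//; ring.
Qed.

Lemma is_prob_symm mu : is_prob mu -> is_prob (symm mu).
Proof.
move=> pmu; apply/is_probP; split; first by move=> k; exact: pmu.1.
  exact: absum_symm.
by rewrite sumZ_symm// prob_sum.
Qed.

Lemma l1norm_real (a : ell1 R) : l1norm (fun k => (a k)%:C%C) = (norm1 a)%:E.
Proof.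
rewrite /l1norm /norm1 -EFin_sumZ; last exact: absum_norm.
by apply: eq_integral => k _; rewrite normc_real.
Qed.

(** The weight [n + 1] instead of [n] makes room for [n = 0], where the splittings of
    [n] used below may end. *)
Lemma rittP mu : is_prob mu -> ritt mu <->
  exists C, forall n, n.+1%:R * norm1 (mu ^+ n * (1 - mu)) <= C.
Proof.
move=> pmu; rewrite /ritt; set S := [set _ | n in _].
have normE n : l1norm (fun k => (convol_pow mu n k - convol_pow mu n.+1 k)%:C%C) =
    (norm1 (mu ^+ n * (1 - mu)))%:E.
  rewrite !ell1X -l1norm_real; congr l1norm; apply/funext => k.
  by rewrite -ell1B exprSr mulrBr mulr1.
split=> [Sy|[C HC]]; last first.
  apply: (@le_lt_trans _ _ C%:E); last exact: ltry.
  apply: ub_ereal_sup => _ [n n1 <-]; rewrite normE -EFinM lee_fin.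
  by rewrite (le_trans _ (HC n))// ler_wpM2r ?norm1_ge0// ler_nat.
have S0 : (0 <= ereal_sup S)%E.
  apply: ereal_sup_ge; exists (1%:R%:E *
    l1norm (fun k => (convol_pow mu 1 k - convol_pow mu 2 k)%:C%C))%E.
    by exists 1%N.
  by rewrite normE -EFinM lee_fin mulr_ge0// norm1_ge0.
have Sf : ereal_sup S \is a fin_num by rewrite ge0_fin_numE.
exists (2 + 2 * fine (ereal_sup S)) => n.
have fS : 0 <= fine (ereal_sup S) by rewrite fine_ge0.
case: n => [|n].
  rewrite mul1r expr0 mul1r (le_trans (norm1B _ _))// norm1_1 norm1_prob//; lra.
have : n.+1%:R * norm1 (mu ^+ n.+1 * (1 - mu)) <= fine (ereal_sup S).
  rewrite -lee_fin fineK// EFinM -normE; apply: ereal_sup_ubound.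
  by exists n.+1.
have : (n.+2%:R : R) <= 2 * n.+1%:R by rewrite -natrM ler_nat; lia.
move/(ler_wpM2r (norm1_ge0 (mu ^+ n.+1 * (1 - mu)))).
by lra.
Qed.

(** [1 - mu * nu = (1 - mu) + mu * (1 - nu)], the remaining powers being
    contractions. *)
Lemma ritt_convol mu nu : is_prob mu -> is_prob nu -> ritt mu -> ritt nu ->
  ritt (convol mu nu).
Proof.
move=> pmu pnu /(rittP pmu)[C HC] /(rittP pnu)[D HD].
apply/(rittP (mu := mu * nu)); first exact: is_prob_convol.
exists (C + D) => n; have n0 : 0 <= (n.+1%:R : R) by rewrite ler0n.
have -> : (mu * nu) ^+ n * (1 - mu * nu) =
    mu ^+ n * (1 - mu) * nu ^+ n + mu ^+ n.+1 * (nu ^+ n * (1 - nu)).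
  by rewrite exprMn exprS; ring.
have b1 k : norm1 (mu ^+ k) <= 1 by rewrite norm1X_le1// norm1_prob.
have b2 k : norm1 (nu ^+ k) <= 1 by rewrite norm1X_le1// norm1_prob.
have h1 := le_trans (norm1M (mu ^+ n * (1 - mu)) (nu ^+ n))
  (ler_wpM2l (norm1_ge0 _) (b2 n)).
have h2 := le_trans (norm1M (mu ^+ n.+1) (nu ^+ n * (1 - nu)))
  (ler_wpM2r (norm1_ge0 _) (b1 n.+1)).
rewrite mulr1 in h1; rewrite mul1r in h2.
apply: le_trans (ler_wpM2l n0 (norm1D _ _)) _; rewrite mulrDr; apply: lerD.
  exact: le_trans (ler_wpM2l n0 h1) (HC n).
exact: le_trans (ler_wpM2l n0 h2) (HD n).
Qed.

(** Expanding by the binomial theorem, the bound on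
    [mu ^+ (n - i) * (1 - mu)] turns ['C(n, i) / (n - i + 1)] into
    ['C(n.+1, i) / (n + 1)], and the binomial theorem sums these weights. *)
Lemma ritt_conv_half mu nu r C : 0 < r < 1 -> is_prob nu ->
  (forall n, n.+1%:R * norm1 (mu ^+ n * (1 - mu)) <= C) -> forall n,
  n.+1%:R * norm1 ((r *: mu + (1 - r) *: nu) ^+ n * (1 - mu)) <= C / r.
Proof.
move=> /andP[r0 r1] pnu HC n; have s0 : 0 < 1 - r by lra.
have C0 : 0 <= C by apply: le_trans (HC 0%N); rewrite mulr_ge0// norm1_ge0.
have n0 : 0 <= (n.+1%:R : R) by rewrite ler0n.
pose w i : R := r ^+ (n - i) * (1 - r) ^+ i.
have w0 i : 0 <= w i by rewrite mulr_ge0// exprn_ge0// ltW.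
have -> : (r *: mu + (1 - r) *: nu) ^+ n * (1 - mu) =
   \sum_(i < n.+1) ('C(n, i)%:R * w i) *: (mu ^+ (n - i) * (1 - mu) * nu ^+ i).
  rewrite exprDn mulr_suml; apply: eq_bigr => i _.
  rewrite !exprZn -scalerAl -scalerAr scalerA -scaler_nat scalerA -scalerAl.
  by rewrite mulrAC.
have b2 k : norm1 (nu ^+ k) <= 1 by rewrite norm1X_le1// norm1_prob.
have term (i : 'I_n.+1) : n.+1%:R * norm1 (('C(n, i)%:R * w i) *:
      (mu ^+ (n - i) * (1 - mu) * nu ^+ i)) <= C * ('C(n.+1, i)%:R * w i).
  have le_in : (i <= n)%N by rewrite -ltnS.
  have d0 : 0 < ((n - i).+1%:R : R) by rewrite ltr0n.
  have Cw : 0 <= 'C(n.+1, i)%:R * w i by rewrite mulr_ge0.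
  have H : norm1 (mu ^+ (n - i) * (1 - mu) * nu ^+ i) <= C / (n - i).+1%:R.
    rewrite (le_trans (norm1M _ _))// -[leRHS]mulr1 ler_pM ?norm1_ge0//.
    by rewrite ler_pdivlMr// mulrC.
  have bin : n.+1%:R * 'C(n, i)%:R = (n - i).+1%:R * 'C(n.+1, i)%:R :> R.
    by rewrite -!natrM -subSn// -mul_bin_down.
  have CCw : 0 <= 'C(n, i)%:R * w i by rewrite mulr_ge0.
  rewrite norm1Z (ger0_norm CCw) [leLHS]mulrA (mulrA n.+1%:R) bin.
  have Q0 : 0 <= (n - i).+1%:R * 'C(n.+1, i)%:R * w i by rewrite -mulrA mulr_ge0// ltW.
  apply: le_trans (ler_wpM2l Q0 H) _.
  rewrite le_eqVlt; apply/orP; left; apply/eqP; field.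
  by rewrite gt_eqF.
rewrite ler_pdivlMr//.
have sum_le : n.+1%:R * norm1 (\sum_(i < n.+1) ('C(n, i)%:R * w i) *:
     (mu ^+ (n - i) * (1 - mu) * nu ^+ i)) <= C * \sum_(i < n.+1) 'C(n.+1, i)%:R * w i.
  rewrite (le_trans (ler_wpM2l n0 (norm1_sum _ _ _)))// !mulr_sumr.
  by apply: ler_sum => i _; exact: term.
apply: le_trans (ler_wpM2r (ltW r0) sum_le) _.
rewrite -mulrA -[leRHS]mulr1 ler_wpM2l// mulr_suml.
have E1 := exprDn r (1 - r) n.+1.
rewrite addrC subrK expr1n big_ord_recr /= in E1; rewrite [leRHS]E1.
rewrite -[leLHS]addr0 lerD//; last by rewrite mulrn_wge0// mulr_ge0// exprn_ge0// ltW.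
apply: ler_sum => i _; rewrite /w -[leRHS]mulr_natl subSn ?exprS; last by rewrite -ltnS.
by rewrite le_eqVlt; apply/orP; left; apply/eqP; ring.
Qed.

(** [1 - (r mu + (1 - r) nu)] is the corresponding combination of [1 - mu] and
    [1 - nu]; each term is covered by [ritt_conv_half], by symmetry for the second. *)
Lemma ritt_conv mu nu r : 0 < r < 1 -> is_prob mu -> is_prob nu ->
  ritt mu -> ritt nu -> ritt (r *: mu + (1 - r) *: nu : ell1 R).
Proof.
move=> r01 pmu pnu /(rittP pmu)[C HC] /(rittP pnu)[D HD].
have [r0 r1] := andP r01.
have s01 : 0 < 1 - r < 1 by apply/andP; split; lra.
apply/rittP; first exact: is_prob_conv.
exists (C + D) => n; have n0 : 0 <= (n.+1%:R : R) by rewrite ler0n.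
set T := (r *: mu + (1 - r) *: nu : ell1 R).
have -> : T ^+ n * (1 - T) = r *: (T ^+ n * (1 - mu)) + (1 - r) *: (T ^+ n * (1 - nu)).
  rewrite !scalerAr -mulrDr; congr (_ * _); rewrite /T !scalerBr addrACA -scalerDl.
  have -> : r + (1 - r) = 1 by ring.
  by rewrite scale1r opprD.
have h1 := ritt_conv_half r01 pnu HC n.
have h2 := ritt_conv_half s01 pmu HD n.
rewrite subKr addrC -/T in h2; rewrite -/T in h1.
rewrite ler_pdivlMr// in h1; rewrite ler_pdivlMr in h2; last lra.
apply: le_trans (ler_wpM2l n0 (norm1D _ _)) _.
have s0 : 0 < 1 - r by rewrite subr_gt0.
rewrite (norm1Z r) (norm1Z (1 - r)) (gtr0_norm r0) (gtr0_norm s0) mulrDr.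
by apply: lerD; rewrite mulrCA mulrC.
Qed.

Lemma symm_pow mu n : convol_pow (symm mu) n = symm (convol_pow mu n).
Proof.
have sE (a b : ell1 R) : convol (symm a) (symm b) = symm (convol a b).
  apply/funext => k; rewrite /convol /symm.
  rewrite -(sumZ_symm (absum_convol_term (- k) (ell1_absum a) (ell1_absum b))).
  by apply: eq_sumZ => j; rewrite /symm opprB opprK addrC.
elim: n => [|n IHn].
  by apply/funext => k; rewrite /symm /= /delta0 oppr_eq0.
by rewrite /convol_pow !iterS -!/(convol_pow _ n) IHn ell1X sE.
Qed.

Lemma ritt_symm mu : ritt mu -> ritt (symm mu).
Proof.
have E n : l1norm (fun k => (convol_pow (symm mu) n k - convol_pow (symm mu) n.+1 k)%:C%C)
    = l1norm (fun k => (convol_pow mu n k - convol_pow mu n.+1 k)%:C%C).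
  rewrite !symm_pow /l1norm /symm.
  apply: (@ge0_sumZ_bij R -%R -%R (fun k =>
   (Normc.normc (convol_pow mu n k - convol_pow mu n.+1 k)%:C%C)%:E)).
  - by move=> k; rewrite opprK.
  - by move=> k; rewrite opprK.
  - by move=> k; rewrite lee_fin normc_ge0.
move=> H; apply: le_lt_trans H; apply: ub_ereal_sup => _ [n n1 <-].
by rewrite E; apply: ereal_sup_ubound; exists n.
Qed.

(** Induction on [m]: one half of the [n] factors [mu] is spent on one factor
    [1 - mu], the other half on the [m] remaining ones. *)
Lemma ritt_power_bound mu : is_prob mu -> ritt mu -> forall m, exists A : R,
  forall n, n.+1%:R ^+ m * norm1 (mu ^+ n * (1 - mu) ^+ m) <= A.
Proof.
move=> pmu /(rittP pmu)[C HC]; elim=> [|m [A HA]].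
  exists 1 => n; rewrite expr0 mul1r expr0 mulr1 norm1X_le1// norm1_prob//.
exists (2 ^+ m * A * (2 * C)) => n.
pose p := (n./2)%N; pose q := (n - p)%N.
have nE : n = (q + p)%N by rewrite /q /p; lia.
have np : (n.+1%:R : R) <= 2 * p.+1%:R by rewrite -natrM ler_nat /p; lia.
have nq : (n.+1%:R : R) <= 2 * q.+1%:R by rewrite -natrM ler_nat /q /p; lia.
have n0 : 0 <= (n.+1%:R : R) by rewrite ler0n.
have -> : mu ^+ n * (1 - mu) ^+ m.+1 =
    (mu ^+ q * (1 - mu) ^+ m) * (mu ^+ p * (1 - mu)).
  by rewrite {1}nE exprD exprSr; ring.
rewrite exprSr (@le_trans _ _ ((n.+1%:R ^+ m * norm1 (mu ^+ q * (1 - mu) ^+ m)) *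
   (n.+1%:R * norm1 (mu ^+ p * (1 - mu)))))//.
  rewrite [leRHS]mulrACA ler_wpM2l ?norm1M// mulr_ge0// exprn_ge0//.
apply: ler_pM.
- by rewrite mulr_ge0 ?norm1_ge0// exprn_ge0.
- by rewrite mulr_ge0 ?norm1_ge0.
- apply: (@le_trans _ _ (2 ^+ m * (q.+1%:R ^+ m * norm1 (mu ^+ q * (1 - mu) ^+ m)))).
    by rewrite mulrA -exprMn ler_wpM2r ?norm1_ge0// lerXn2r ?nnegrE ?mulr_ge0 ?ler0n.
  by rewrite ler_wpM2l// exprn_ge0.
- apply: (@le_trans _ _ (2 * (p.+1%:R * norm1 (mu ^+ p * (1 - mu))))).
    by rewrite mulrA ler_wpM2r ?norm1_ge0.
  by rewrite ler_wpM2l.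
Qed.

End ritt_measures.

(** * Complex-valued functions *)

Section complex_weak_type.
Context {R : realType}.
Implicit Types (K : ell1 R) (f : int -> R[i]).
Local Notation normc := Normc.normc.

Lemma l1_parts f : l1 f -> absum (fun k => complex.Re (f k)) /\ absum (fun k => complex.Im (f k)).
Proof.
move=> fl; have sn : absum (fun k => normc (f k)).
  apply/absumP; rewrite (eq_integral (fun k : int => (normc (f k))%:E))// => k _.
  by rewrite ger0_norm// normc_ge0.
by split; apply: le_absum sn => k; [exact: norm_Re_le|exact: norm_Im_le].
Qed.

Lemma cconvolE (a : int -> R) f k : cconvol a f k =
  (convol a (fun j => complex.Re (f j)) k +i* convol a (fun j => complex.Im (f j)) k)%C.
Proof.
apply: eq_complexP; apply: eq_sumZ => j; rewrite (ReM, ImM) /= mul0r.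
  by rewrite subr0.
by rewrite addr0.
Qed.

(** Moves the weight [n ^ m] of the maximal function into the kernel. *)
Lemma normc_cconvolZ (r : R) K f k : 0 <= r -> l1 f ->
  r * normc (cconvol K f k) = normc (cconvol (r *: K : ell1 R) f k).
Proof.
move=> r0 /l1_parts[sR sI]; rewrite !cconvolE.
have E (g : int -> R) : absum g -> convol (r *: K : ell1 R) g k = r * convol K g k.
  move=> sg; rewrite /convol -sumZZ; last exact: absum_convol_term.
  by apply: eq_sumZ => j; rewrite ell1Z mulrA.
by rewrite !E//= !exprMn -mulrDr sqrtrM ?sqr_ge0// sqrtr_sqr ger0_norm.
Qed.

(** Where the maximal function of [f] is at least [lam], that of its real or of its
    imaginary part is at least [lam / 2]. *)
Lemma weak_type (K : nat -> ell1 R) (A D : R) : 0 < A -> 0 <= D ->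
  (forall n, (0 < n)%N -> norm1 (K n) <= A) ->
  (forall n (y : int), (0 < n)%N -> y != 0 ->
     `|K n y - K n (y + 1)| <= D / y%:~R ^+ 2) ->
  forall f, l1 f -> forall lam : R, 0 < lam ->
  (counting [set k : int | (lam%:E <= ereal_sup
       [set (normc (cconvol (K n) f k))%:E | n in [set n : nat | (1 <= n)%N]])%E]
   <= (4 * (20 * A + 16 * D) / lam)%:E * l1norm f)%E.
Proof.
move=> A0 D0 KA KD f fl lam lam0; have [sR sI] := l1_parts fl.
pose fR := mk_ell1 sR; pose fI := mk_ell1 sI.
have l2 : 0 < lam / 2 by rewrite divr_gt0.
pose S (g : ell1 R) := [set k : int | ((lam / 2)%:E <= ereal_sup
       [set `|(K n * g)%R k|%:E | n in [set n : nat | (1 <= n)%N]])%E].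
have wR := weak_type_real A0 D0 KA KD fR l2.
have wI := weak_type_real A0 D0 KA KD fI l2.
have nf (g : int -> R) (sg : absum g) : (forall k, `|g k| <= normc (f k)) ->
    ((norm1 (mk_ell1 sg))%:E <= l1norm f)%E.
  move=> gf; rewrite /norm1 -EFin_sumZ; last exact: absum_norm.
  apply: ge0_le_integral => // k _.
  by rewrite lee_fin.
have nR := nf _ sR (fun k => norm_Re_le (f k)).
have nI := nf _ sI (fun k => norm_Im_le (f k)).
apply: (@le_trans _ _ (counting (S fR `|` S fI))).
  apply: le_measure; rewrite ?inE// => k lk.
  apply: contrapT => /not_orP[/negP + /negP]; rewrite -!ltNge => kR kI.
  suff : (lam%:E < lam%:E :> \bar R)%E by rewrite ltxx.
  apply: (le_lt_trans lk).
  rewrite [X in (_ < X%:E)%E](_ : lam = lam / 2 + lam / 2); last by lra.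
  rewrite EFinD; apply: le_lt_trans (lteD kR kI).
  apply: ub_ereal_sup => _ [n n1 <-]; rewrite cconvolE.
  apply: le_trans (_ : `|(K n * fR)%R k|%:E + `|(K n * fI)%R k|%:E <= _)%E.
    rewrite -EFinD lee_fin; exact: normc_le_Re_Im.
  by apply: leeD; apply: ereal_sup_ubound; exists n.
apply: (le_trans (measureU2 _ _ _)) => //.
apply: (le_trans (leeD wR wI)).
have E0 : 0 <= 20 * A + 16 * D by rewrite addr_ge0// mulr_ge0// ltW.
have E2 : 0 <= (20 * A + 16 * D) / (lam / 2) by rewrite divr_ge0// ltW.
rewrite !EFinM; apply: (le_trans (leeD (lee_wpmul2l _ nR) (lee_wpmul2l _ nI))).
1-2: by rewrite -?EFinM lee_fin.
rewrite -!EFinM -muleDl//; last first.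
  by rewrite ge0_fin_numE// integral_ge0// => k _; rewrite lee_fin normc_ge0.
rewrite -EFinD le_eqVlt; apply/orP; left; apply/eqP; congr (_%:E * _)%E.
by field; rewrite gt_eqF.
Qed.

End complex_weak_type.

Theorem theorem1p2 (R : realType) :
  [/\ [/\ convex_set (H_measures : set (convex_lmodType (int -> R^o))),
          convol_stable (@H_measures R) & symm_stable (@H_measures R)],
      [/\ convex_set (Ritt_measures : set (convex_lmodType (int -> R^o))),
          convol_stable (@Ritt_measures R) & symm_stable (@Ritt_measures R)],
      forall mu : int -> R, H_measures mu ->
        exists2 C : R, 0 < C &
          forall f : int -> R[i], l1 f -> forall lambda : R, 0 < lambda ->
            (counting [set k : int |
               lambda%:E < ereal_sup
                 [set (Normc.normc (cconvol (convol_pow mu n) f k))%:E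
                 | n in [set n : nat | (1 <= n)%N]]]
             <= (C / lambda)%:E * l1norm f)%E &
      forall mu : int -> R, (H_measures `&` Ritt_measures) mu ->
        forall m : nat, exists2 C : R, 0 < C &
          forall f : int -> R[i], l1 f ->
            (ereal_sup [set lambda%:E * counting [set k : int |
               lambda%:E <= ereal_sup
                 [set (n%:R ^+ m * Normc.normc
                    (cconvol (convol (convol_pow mu n) (convol_pow (delta0 \- mu) m))
                       f k))%:E
                 | n in [set n : nat | (1 <= n)%N]]]
               | lambda in [set lambda : R | (0 < lambda)%R]]
             <= C%:E * l1norm f)%E].
Proof.
have convE (mu nu : ell1 R) (k : {i01 R}) :
    conv k ((mu : int -> R) : convex_lmodType (int -> R^o))
      ((nu : int -> R) : convex_lmodType (int -> R^o)) =
    (k%:num *: mu + (1 - k%:num) *: nu : ell1 R) :> (int -> R).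
  by [].
split.
- split.
  + apply/convex_setW => mu nu /set_mem[pmu Hmu] /set_mem[pnu Hnu] k k0 k1.
    have k01 : 0 < k%:num < 1 by rewrite k0.
    apply/mem_set; have E := convE (prob_ell1 pmu) (prob_ell1 pnu) k.
    rewrite E; split; first exact: is_prob_conv.
    exact: (@hypH_conv R (prob_ell1 pmu) (prob_ell1 pnu) k%:num k01 Hmu Hnu).
  + move=> mu nu [pmu Hmu] [pnu Hnu]; split.
      exact: (@is_prob_convol R (prob_ell1 pmu) (prob_ell1 pnu) pmu pnu).
    exact: (@hypH_convol R (prob_ell1 pmu) (prob_ell1 pnu) Hmu Hnu).
  + move=> mu [pmu Hmu]; split; first exact: (@is_prob_symm R (prob_ell1 pmu) pmu).
    exact: (@hypH_symm R (prob_ell1 pmu) Hmu).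
- split.
  + apply/convex_setW => mu nu /set_mem[pmu Hmu] /set_mem[pnu Hnu] k k0 k1.
    have k01 : 0 < k%:num < 1 by rewrite k0.
    apply/mem_set; have E := convE (prob_ell1 pmu) (prob_ell1 pnu) k.
    rewrite E; split; first exact: is_prob_conv.
    exact: (@ritt_conv R (prob_ell1 pmu) (prob_ell1 pnu) k%:num k01 pmu pnu Hmu Hnu).
  + move=> mu nu [pmu Hmu] [pnu Hnu]; split.
      exact: (@is_prob_convol R (prob_ell1 pmu) (prob_ell1 pnu) pmu pnu).
    exact: (@ritt_convol R (prob_ell1 pmu) (prob_ell1 pnu) pmu pnu Hmu Hnu).
  + move=> mu [pmu Hmu]; split; first exact: (@is_prob_symm R (prob_ell1 pmu) pmu).
    exact: (@ritt_symm R (prob_ell1 pmu) Hmu).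
- move=> mu [pmu Hmu]; pose a : ell1 R := prob_ell1 pmu.
  have [D D0 HD] := @kernel_regular R a 0 pmu Hmu.
  have KE n : n%:R ^+ 0 *: (a ^+ n * (1 - a) ^+ 0) = a ^+ n.
    by rewrite !expr0 mulr1 scale1r.
  have KA n : (0 < n)%N -> norm1 (a ^+ n) <= 1.
    by move=> _; rewrite norm1X_le1// norm1_prob.
  have KD n (y : int) : (0 < n)%N -> y != 0 ->
      `|(a ^+ n) y - (a ^+ n) (y + 1)| <= D / y%:~R ^+ 2.
    by move=> n0 y0; have := HD n y n0 y0; rewrite KE.
  exists (4 * (20 * 1 + 16 * D)); first by rewrite mulr_gt0//; lra.
  move=> f fl lam lam0.
  apply: le_trans (weak_type ltr01 (ltW D0) KA KD fl lam0).
  have KX (k : int) : (fun n : nat => (Normc.normc (cconvol (convol_pow mu n) f k))%:E) =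
      (fun n : nat => (Normc.normc (cconvol (a ^+ n : ell1 R) f k))%:E).
    by apply/funext => n; rewrite (ell1X a n).
  apply: le_measure; [by rewrite inE..|move=> k lk].
  rewrite /= -KX; exact: ltW.
- move=> mu [[pmu Hmu] [_ Rmu]] m; pose a : ell1 R := prob_ell1 pmu.
  have [D D0 HD] := @kernel_regular R a m pmu Hmu.
  have [A HA] := @ritt_power_bound R a pmu Rmu m.
  have KA n : (0 < n)%N -> norm1 (n%:R ^+ m *: (a ^+ n * (1 - a) ^+ m)) <= `|A| + 1.
    move=> _; rewrite norm1Z normrX ger0_norm// (@le_trans _ _ A)//.
      rewrite (le_trans _ (HA n))// ler_wpM2r ?norm1_ge0//.
      by rewrite lerXn2r ?nnegrE ?ler0n// ler_nat.
    by rewrite (le_trans (ler_norm A))// lerDl.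
  have A0 : 0 < `|A| + 1 by rewrite ltr_wpDl.
  exists (4 * (20 * (`|A| + 1) + 16 * D)).
    by rewrite !mulr_gt0// addr_gt0// mulr_gt0.
  move=> f fl; apply: ub_ereal_sup => _ [lam lam0 <-].
  have KE (k : int) : (fun n : nat => (n%:R ^+ m * Normc.normc
      (cconvol (convol (convol_pow mu n) (convol_pow (delta0 \- mu) m)) f k))%:E) =
    (fun n : nat => (Normc.normc
      (cconvol (n%:R ^+ m *: (a ^+ n * (1 - a) ^+ m) : ell1 R) f k))%:E).
    apply/funext => n; have nm0 : 0 <= (n%:R : R) ^+ m by rewrite exprn_ge0.
    have E2 : convol_pow (delta0 \- mu) m = ((1 - a) ^+ m : ell1 R) := ell1X (1 - a) m.
    by rewrite -(normc_cconvolZ (a ^+ n * (1 - a) ^+ m) k nm0 fl) (ell1X a n) E2.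
  have := weak_type A0 (ltW D0) KA HD fl lam0.
  under [X in counting X]eq_fun do rewrite -KE.
  move=> H; apply: (le_trans (lee_wpmul2l _ H)); first by rewrite lee_fin ltW.
  rewrite muleA -EFinM le_eqVlt; apply/orP; left; apply/eqP; congr (_%:E * _)%E.
  by rewrite mulrC divfK// gt_eqF.
Qed.
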